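(* Let $k$ be measurable, bounded and uniformly positive, let $\mathbf{A},\mathbf{L}\in\mathbb{R}^{N\times N}$ be the finite element stiffness matrices $[\mathbf{A}]_{ij}=\int_\Omega \nabla\phi_i\cdot k\nabla\phi_j$ and $[\mathbf{L}]_{ij}=\int_\Omega\nabla\phi_i\cdot\nabla\phi_j$, and let $0<\lambda_1\le\lambda_2\le\dots\le\lambda_N$ be the eigenvalues of $\mathbf{L}^{-1}\mathbf{A}$, counted with multiplicity. Then there exists a (possibly non-unique) permutation $\pi$ of $\{1,\dots,N\}$ such that $$\lambda_{\pi(j)}\in k(\mathcal{T}_j),\qquad j=1,\dots,N,$$ where $\mathcal{T}_j=\mathrm{supp}(\phi_j)$ and $k(\mathcal{T}_j)$ denotes the closed interval $[\inf_{x\in\mathcal{T}_j}k(x),\ \sup_{x\in\mathcal{T}_j}k(x)]$.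
   Context: Setting. $\Omega\subset\mathbb{R}^d$, $d\in\{1,2,3\}$, is a bounded domain. The coefficient $k$ is a real-valued, bounded, measurable function, defined pointwise on $\overline{\Omega}$, which is uniformly positive: there is $\alpha>0$ with $k(x)\ge\alpha$ for all $x\in\Omega$. No continuity of $k$ is assumed. $V_h\subset H_0^1(\Omega)$ is a conforming finite element space on a mesh of $\Omega$, with basis $\phi_1,\dots,\phi_N$ of (linearly independent) piecewise polynomial nodal basis functions with local supports. $\mathcal{T}_j=\mathrm{supp}(\phi_j)\subset\overline{\Omega}$ is the (closed) support of $\phi_j$. The matrices $\mathbf{A}$ and $\mathbf{L}$ represent, in this basis, the bilinear forms $\int_\Omega k\nabla u\cdot\nabla v$ and $\int_\Omega\nabla u\cdot\nabla v$ on $V_h$; both are symmetric positive definite. Notation: $k(\mathcal{T}_j)$ always denotes the closed interval above (which need not be the image of $\mathcal{T}_j$ under $k$ when $k$ is discontinuous). *)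

(* Defs.v *)
From HB Require Import structures.
From mathcomp Require Import all_boot all_order all_algebra all_fingroup.
From mathcomp Require Import all_classical all_reals all_analysis.
From mathcomp Require mpoly.

Set Implicit Arguments.
Unset Strict Implicit.
Unset Printing Implicit Defensive.

Import Order.TTheory GRing.Theory Num.Theory.
Import numFieldNormedType.Exports.

Local Open Scope classical_set_scope.
Local Open Scope ring_scope.

(* The sigma-algebra on R^n generated by the coordinate maps, i.e. the Borel
   sigma-algebra, and the n-dimensional Lebesgue measure, obtained from
   R^(1+n) = R * R^n by iterating the product measure. *)

Definition measure_rV_display : measure_display.
Proof. exact. Qed.

Section measurable_rV.
Context {R : realType} {n : nat}.

Let coors : 'I_n -> 'rV[R]_n -> measurableTypeR R := fun i x => x ord0 i.

Let rV_set0 : g_sigma_preimage coors set0.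
Proof. exact: sigma_algebra0. Qed.

Let rV_setC A : g_sigma_preimage coors A -> g_sigma_preimage coors (~` A).
Proof. exact: sigma_algebraC. Qed.

Let rV_bigcup (F : _^nat) : (forall i, g_sigma_preimage coors (F i)) ->
  g_sigma_preimage coors (\bigcup_i (F i)).
Proof. exact: sigma_algebra_bigcup. Qed.

HB.instance Definition _ := @isMeasurable.Build measure_rV_display
  'rV[R]_n (g_sigma_preimage coors) rV_set0 rV_setC rV_bigcup.

End measurable_rV.

Section measurable_rV_theory.
Context {R : realType}.

Let coord n (i : 'I_n) : 'rV[R]_n -> measurableTypeR R := fun x => x ord0 i.

Lemma measurable_coord n (i : 'I_n) : measurable_fun setT (coord i).
Proof.
move=> _ Y mY; rewrite setTI; apply: sub_sigma_algebra => /=.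
rewrite -bigcup_seq/=; exists i => /=; first by rewrite mem_index_enum.
by exists Y => //; rewrite setTI.
Qed.

Lemma measurable_fun_rVP d (T : measurableType d) n (f : T -> 'rV[R]_n) :
  (forall i, measurable_fun setT (coord i \o f)) -> measurable_fun setT f.
Proof.
move=> mf; apply: (@measurability _ _ _ _ _ _
  (\big[setU/set0]_(i < n) preimage_set_system setT (coord i) measurable)) => //.
move=> _ [B + <-].
rewrite -bigcup_seq => -[i _ [C mC <-]].
by rewrite setTI; exact: mf.
Qed.

Definition rV_cons n (p : measurableTypeR R * 'rV[R]_n) : 'rV[R]_n.+1 :=
  row_mx (p.1)%:M p.2.

Definition rV_uncons n (x : 'rV[R]_n.+1) : measurableTypeR R * 'rV[R]_n :=
  (x ord0 ord0, \row_i x ord0 (lift ord0 i)).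

Lemma rV_cons0 n p : @rV_cons n p ord0 ord0 = p.1.
Proof.
have -> : (ord0 : 'I_n.+1) = lshift n (ord0 : 'I_1) by exact: val_inj.
by apply: etrans (row_mxEl _ _ _ _) _; rewrite mxE.
Qed.

Lemma rV_consS n p i : @rV_cons n p ord0 (lift ord0 i) = p.2 ord0 i.
Proof. by rewrite -rshift1; exact: row_mxEr. Qed.

Lemma rV_consK n : cancel (@rV_cons n) (@rV_uncons n).
Proof.
case=> t v; congr pair; first exact: rV_cons0.
by apply/rowP => i; rewrite mxE rV_consS.
Qed.

Lemma measurable_rV_cons n : measurable_fun setT (@rV_cons n).
Proof.
apply: measurable_fun_rVP => i.
case: (unliftP ord0 i) => [j ->|->].
  rewrite (_ : _ \o _ = coord j \o snd); last first.
    by apply/funext => x /=; rewrite /coord rV_consS.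
  by apply: measurableT_comp => //; exact: measurable_coord.
rewrite (_ : _ \o _ = fst); first exact: measurable_fst.
by apply/funext => x /=; rewrite /coord rV_cons0.
Qed.

Lemma measurable_rV_uncons n : measurable_fun setT (@rV_uncons n).
Proof.
apply/measurable_fun_pairP; split; first exact: measurable_coord.
apply: measurable_fun_rVP => i.
rewrite (_ : _ \o _ = coord (lift ord0 i)); first exact: measurable_coord.
by apply/funext => x; rewrite /coord /= mxE.
Qed.

Section lebesgue_rV_step.
Variables (n : nat) (mu : {sigma_finite_measure set 'rV[R]_n -> \bar R}).

Definition lebesgue_rV_step : set 'rV[R]_n.+1 -> \bar R :=
  pushforward (@lebesgue_measure R \x mu)%E (@rV_cons n).

Let step0 : lebesgue_rV_step set0 = 0%E.
Proof. by rewrite /lebesgue_rV_step /pushforward preimage_set0 measure0. Qed.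

Let step_ge0 A : (0 <= lebesgue_rV_step A)%E.
Proof. by rewrite /lebesgue_rV_step /pushforward measure_ge0. Qed.

Let step_sigma_additive : semi_sigma_additive lebesgue_rV_step.
Proof.
move=> F mF tF mUF; rewrite /lebesgue_rV_step /pushforward preimage_bigcup.
have mcons A : measurable A -> measurable (@rV_cons n @^-1` A).
  by move=> mA; rewrite -[X in measurable X]setTI; exact: measurable_rV_cons.
apply: measure_semi_sigma_additive.
- by move=> k; exact: mcons.
- apply/trivIsetP => /= i j _ _ ij; rewrite -preimage_setI.
  by move/trivIsetP : tF => /(_ _ _ _ _ ij) ->//; rewrite preimage_set0.
- by rewrite -preimage_bigcup; exact: mcons.
Qed.

HB.instance Definition _ := isMeasure.Build _ _ _ lebesgue_rV_step
  step0 step_ge0 step_sigma_additive.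

Let step_sigma_finite : sigma_finite setT lebesgue_rV_step.
Proof.
have /sigma_finiteP[F [TF ndF Foo]] := sigma_finiteT (@lebesgue_measure R).
have /sigma_finiteP[G [TG ndG Goo]] := sigma_finiteT mu.
exists (fun k => @rV_uncons n @^-1` (F k `*` G k)).
  apply/seteqP; split => // x _.
  have [i _ Fi] : (\bigcup_k F k) (@rV_uncons n x).1 by rewrite -TF.
  have [j _ Gj] : (\bigcup_k G k) (@rV_uncons n x).2 by rewrite -TG.
  exists (maxn i j) => //; split.
    by move: Fi; exact/subsetPset/ndF/leq_maxl.
  by move: Gj; exact/subsetPset/ndG/leq_maxr.
move=> k; have [mF Fk] := Foo k; have [mG Gk] := Goo k; split.
  rewrite -[X in measurable X]setTI; apply: measurable_rV_uncons => //.
  exact: measurableX.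
rewrite /lebesgue_rV_step /pushforward -comp_preimage.
rewrite (_ : _ \o _ = id) ?preimage_id; last first.
  by apply/funext => x /=; rewrite rV_consK.
by rewrite product_measure1E// lte_mul_pinfty// ge0_fin_numE.
Qed.

HB.instance Definition _ := Measure_isSigmaFinite.Build _ _ _ lebesgue_rV_step
  step_sigma_finite.

End lebesgue_rV_step.

Fixpoint lebesgue_rV n : {sigma_finite_measure set 'rV[R]_n -> \bar R} :=
  match n with
  | 0 => \d_(0 : 'rV[R]_0)
  | n'.+1 => lebesgue_rV_step (lebesgue_rV n')
  end.

End measurable_rV_theory.

Section sobolev.
Context {R : realType} {d : nat}.
Implicit Types (Omega D K : set 'rV[R]_d) (u f : 'rV[R]_d -> R).

Definition bounded_domain Omega : Prop :=
  [/\ open Omega, connected Omega, Omega !=set0 & bounded_set Omega].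

(* Lebesgue measurability, the sigma-algebra on 'rV[R]_d being the Borel one:
   f agrees on D, up to a Lebesgue-null set, with a Borel function.  The
   library integral of such an f is its Lebesgue integral. *)
Definition Lebesgue_measurable D f : Prop :=
  exists2 g : 'rV[R]_d -> R, measurable_fun D g &
    {ae lebesgue_rV d, forall x, D x -> f x = g x}.

Definition supp D f : set 'rV[R]_d := closure [set x | D x /\ f x != 0].

Definition partial (l : 'I_d) f : 'rV[R]_d -> R :=
  fun x => 'D_(delta_mx ord0 l) f x.

Fixpoint continuously_differentiable m f : Prop :=
  match m with
  | 0 => continuous f
  | m'.+1 => (forall x, differentiable f x) /\
             forall l, continuously_differentiable m' (partial l f)
  end.

(* C_c^oo(Omega), extended by zero to R^d *)
Definition test_function Omega f : Prop :=
  [/\ forall m, continuously_differentiable m f,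
      compact (supp setT f) & supp setT f `<=` Omega].

(* H^1_0(Omega) is the closure of C_c^oo(Omega) in H^1(Omega): psi_m --> u and
   partial_l psi_m --> g_l in L^2(Omega), and then g is the weak gradient
   of u. *)
Definition H10 Omega u : Prop :=
  Lebesgue_measurable Omega u /\
  exists (g : 'I_d -> 'rV[R]_d -> R) (psi : nat -> 'rV[R]_d -> R),
    [/\ forall l, measurable_fun Omega (g l),
        forall m, test_function Omega (psi m),
        (\int[lebesgue_rV d]_(x in Omega) ((psi m x - u x) ^+ 2)%:E)%E
          @[m --> \oo] --> 0%E &
        forall l, (\int[lebesgue_rV d]_(x in Omega)
          ((partial l (psi m) x - g l x) ^+ 2)%:E)%E @[m --> \oo] --> 0%E].

End sobolev.

Section finite_elements.
Context {R : realType} {d : nat}.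
Implicit Types (Omega K : set 'rV[R]_d) (cells : set (set 'rV[R]_d)).

Definition mesh_cell K : Prop :=
  [/\ K !=set0, compact K, K = closure K° &
      (lebesgue_rV d).-negligible (K `\` K°)].

Definition mesh Omega cells : Prop :=
  [/\ finite_set cells,
      forall K, cells K -> mesh_cell K /\ K° `<=` Omega,
      trivIset cells interior &
      \bigcup_(K in cells) K = closure Omega].

Definition piecewise_polynomial cells (u : 'rV[R]_d -> R) : Prop :=
  forall K, cells K -> exists p : mpoly.mpoly d R,
    forall x, K x -> u x = mpoly.meval (fun l => x ord0 l) p.

(* phi is dual to degrees of freedom ell, each of which is a linear form
   determined by the restriction of its argument to a single cell, such as a
   point value (Lagrange elements) or a derivative (Hermite elements) at a
   node. *)
Definition nodal_basis cells (N : nat) (phi : 'I_N -> 'rV[R]_d -> R) : Prop :=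
  exists ell : 'I_N -> ('rV[R]_d -> R) -> R,
    [/\ forall i a u v,
          ell i (fun x => a * u x + v x) = a * ell i u + ell i v,
        forall i, exists2 K, cells K &
          forall u v, (forall x, K x -> u x = v x) -> ell i u = ell i v &
        forall i j, ell i (phi j) = (i == j)%:R].

Definition fe_basis Omega cells (N : nat) (phi : 'I_N -> 'rV[R]_d -> R)
    : Prop :=
  [/\ forall j, piecewise_polynomial cells (phi j),
      forall j, H10 Omega (phi j),
      forall c : 'I_N -> R,
        (forall x, Omega x -> \sum_j c j * phi j x = 0) -> forall j, c j = 0 &
      nodal_basis cells phi].

(* The gradients are classical: a function polynomial on each cell is
   differentiable off the null skeleton of the mesh, and for one in H^1_0 the
   classical gradient is there a representative of the weak one. *)
Definition stiffness Omega (k : 'rV[R]_d -> R) (N : nat)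
    (phi : 'I_N -> 'rV[R]_d -> R) : 'M[R]_N :=
  \matrix_(i, j) \int[lebesgue_rV d]_(x in Omega)
    (\sum_(l < d) partial l (phi i) x * (k x * partial l (phi j) x)).

(* [inf k(T), sup k(T)] *)
Definition range_itv (k : 'rV[R]_d -> R) (T : set 'rV[R]_d) : interval R :=
  `[inf (k @` T), sup (k @` T)].

End finite_elements.

Definition ordered_positive_spectrum (R : realType) (N : nat) (M : 'M[R]_N)
    (lam : 'I_N -> R) : Prop :=
  [/\ forall i, 0 < lam i,
      forall i j : 'I_N, (i <= j)%N -> lam i <= lam j &
      char_poly M = \prod_i ('X - (lam i)%:P)].

(* Main.v *)
(* Let [lam_s] and [v_s] be the eigenvalues and [L]-orthonormal eigenvectors of
   [invmx L *m A], and let [w] be supported on the indices [j] with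
   [k(T_j)] contained in [c, d].  Since [|k - (c + d) / 2| <= (d - c) / 2]
   wherever the gradient of [w] does not vanish, the operator
   [invmx L *m A - (c + d) / 2] contracts the [L]-norm of [w] by [(d - c) / 2];
   on the span of the [v_s] with [lam_s] outside [c, d] it does not.  Hence at
   least as many eigenvalues lie in [c, d] as there are intervals [k(T_j)]
   contained in [c, d].  For intervals, this counting condition, over all [c]
   and [d], already yields a perfect matching, by a greedy argument.

   [L] is positive definite because a finite element function with zero
   gradient takes one value on each cell, and a function [u] in H^1_0 with
   finitely many values is 0: composing test functions [psi] that tend to [u]
   with an injective [F] whose critical points are the values of [u] gives
   functions with gradients tending to 0 in L^1, so that [F \o u = F 0] by the
   Poincare inequality. *)

Require Import Defs.
From mathcomp Require Import all_boot all_order all_algebra all_fingroup.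
From mathcomp Require Import all_classical all_reals all_analysis.
From mathcomp Require Import measurable_realfun ring lra.
Import Order.TTheory GRing.Theory Num.Theory.
Import numFieldNormedType.Exports.
Local Open Scope classical_set_scope.
Local Open Scope ring_scope.

(** * Matching points with intervals *)

(** The contraction is never phrased with norms. With [m] and [r] the midpoint and the half-length
    of [[c, d]], it enters as [2 * bform (A - m *: L) w z <= r ^+ 2 * bform L w w + bform L z z] for
    arbitrary [z]. This is the integral of a pointwise inequality between squares, so the analysis
    needs neither Cauchy-Schwarz nor the operator [invmx L *m A]; the norm bound comes back when [z]
    satisfies [w *m (A - m *: L) = z *m L]. The eigenvalue count is thereby pure matrix algebra.

    On the analytic side, [k] is Borel only up to a null set and the gradients are controlled only
    inside the cells. Integrals over [Omega] are therefore transferred to a Borel subset of full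
    measure, on which the integrands are bounded and measurable. *)

Lemma exists_min_in {R : realDomainType} {T : finType} (A : {set T}) (f : T -> R) x0 :
  x0 \in A -> exists2 x, x \in A & forall y, y \in A -> f x <= f y.
Proof. by move=> /(Order.TotalTheory.arg_minP f)[x]; exists x. Qed.

Lemma exists_max_in {R : realDomainType} {T : finType} (A : {set T}) (f : T -> R) x0 :
  x0 \in A -> exists2 x, x \in A & forall y, y \in A -> f y <= f x.
Proof. by move=> /(Order.TotalTheory.arg_maxP f)[x]; exists x. Qed.

(* Greedy choice: the smallest point is matched with the interval that, among
   those containing it, has the smallest right endpoint. *)
Lemma interval_matching {R : realDomainType} {I : finType}
    (a b lam : I -> R) (n : nat) (A B : {set I}) :
  #|A| = n -> #|B| = n ->
  (forall c d : R, (#|[set j in A | (c <= a j)%R && (b j <= d)%R]%SET| <=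
                #|[set s in B | (c <= lam s <= d)%R]%SET|)%N) ->
  exists f : I -> I, {in A &, injective f} /\
    forall j, j \in A -> f j \in B /\ a j <= lam (f j) <= b j.
Proof.
elim: n A B => [|n IHn] A B cA cB count.
  move/eqP : cA; rewrite cards_eq0 => /eqP ->.
  by exists id; split => [j|j]; rewrite inE.
have [s1 s1B] : exists s, s \in B by apply/set0Pn; rewrite -card_gt0 cB.
have [j1 j1A] : exists j, j \in A by apply/set0Pn; rewrite -card_gt0 cA.
have [s0 s0B s0min] := exists_min_in _ lam _ s1B.
(* The window [[a j, b j]] must contain a point, and no point is below [lam s0]. *)
have lb j : j \in A -> lam s0 <= b j.
  move=> jA; have : (0 < #|[set s in B | (a j <= lam s <= b j)%R]%SET|)%N.
    apply: leq_trans (count _ _); rewrite card_gt0; apply/set0Pn; exists j.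
    by rewrite inE jA !lexx.
  rewrite card_gt0 => /set0Pn[s]; rewrite inE => /and3P[sB _ sb].
  exact: le_trans (s0min _ sB) sb.
(* If every interval started to the right of [lam s0], the window spanned by all of them would
   contain [n.+1] intervals but miss the point [s0]. *)
have [j2 j2C] : exists j, (j \in A) && (a j <= lam s0).
  have [/existsP //|/existsPn noC] := boolP [exists j, (j \in A) && (a j <= lam s0)].
  have agt j : j \in A -> lam s0 < a j.
    by move=> jA; rewrite ltNge; have := noC j; rewrite jA.
  have [ja jaA jamin] := exists_min_in _ a _ j1A.
  have [jb jbA jbmax] := exists_max_in _ b _ j1A.
  have : (#|A| <= #|B :\ s0|)%N.
    apply: leq_trans (leq_trans (count (a ja) (b jb)) _).
      apply/subset_leq_card/fintype.subsetP => j jA; rewrite inE jA/=.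
      by rewrite jamin//=; exact: jbmax.
    apply/subset_leq_card/fintype.subsetP => s; rewrite !inE => /and3P[-> js _].
    rewrite andbT; apply/eqP => ss0; move: js; rewrite ss0 leNgt.
    by rewrite agt.
  move=> AB; have := cardsD1 s0 B; rewrite s0B cB add1n => -[nE].
  by move: AB; rewrite cA -nE ltnn.
have {}j2C : j2 \in [set j in A | (a j <= lam s0)%R]%SET by rewrite inE.
have [j0 + j0min] := exists_min_in _ b _ j2C; rewrite inE => /andP[j0A j0a].
have cA' : #|A :\ j0| = n by have := cardsD1 j0 A; rewrite j0A cA => -[].
have cB' : #|B :\ s0| = n by have := cardsD1 s0 B; rewrite s0B cB => -[].
have [f [finj fP]] : exists f : I -> I, {in A :\ j0 &, injective f} /\
    forall j, j \in A :\ j0 -> f j \in B :\ s0 /\ a j <= lam (f j) <= b j.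
  apply: IHn => // c d.
  set X := finset _; set Y := finset _.
  (* A window that misses [lam s0] loses no point. *)
  have [/andP[cl ld]|ncld] := boolP (c <= lam s0 <= d); last first.
    apply: leq_trans (leq_trans (count c d) _); apply/subset_leq_card/fintype.subsetP => i.
      by rewrite !inE => /andP[/andP[_ ->]].
    rewrite !inE => /andP[-> ci]; rewrite ci !andbT.
    by apply: contra ncld => /eqP <-.
  (* If [b j0 <= d], the window is stretched to the left to include the interval of [j0]. Both
     counts then drop by one, and the remaining points, being at least [lam s0], still lie in
     [[c, d]]. *)
  have [bd|db] := leP (b j0) d.
    have := count (Num.min c (a j0)) d.
    rewrite (cardsD1 j0) [in X in (_ <= X)%N](cardsD1 s0) !inE j0A s0B bd ld.
    rewrite !ge_min lexx cl orbT /= !add1n ltnS => count'.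
    apply: leq_trans (leq_trans count' _);
      apply/subset_leq_card/fintype.subsetP => i; rewrite !inE.
      by move=> /and3P[/andP[-> ->] ci ->]; rewrite ge_min ci.
    move=> /and4P[-> iB _ ->]; rewrite iB /= andbT.
    by rewrite (le_trans cl)// s0min.
  (* Here [d < b j0], so by minimality of [b j0] every interval left in the window starts after
     [lam s0]. Raising [c] to the smallest such start excludes [s0] and no interval. *)
  have [->|/set0Pn[j3 j3X]] := eqVneq X finset.set0; first by rewrite cards0.
  have [ja jaX jamin] := exists_min_in _ a _ j3X.
  have Xl j : j \in X -> [/\ j \in A, lam s0 < a j, c <= a j & b j <= d].
    rewrite !inE => /and3P[/andP[_ jA] ca bd]; split => //; rewrite ltNge.
    apply/negP => al; have := j0min j; rewrite inE jA al => /(_ isT).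
    by rewrite leNgt (le_lt_trans bd db).
  have [_ la ca _] := Xl _ jaX.
  apply: leq_trans (leq_trans (count (a ja) d) _);
      apply/subset_leq_card/fintype.subsetP => i.
    by move=> iX; have [iA _ _ bid] := Xl _ iX; rewrite inE iA jamin.
  rewrite !inE => /and3P[-> ai ->]; rewrite (le_trans ca ai) !andbT.
  by apply: contraTneq ai => ->; rewrite -ltNge.
exists (fun j => if j == j0 then s0 else f j); split => [i j iA jA|j jA].
  have [->|ij0] := eqVneq i j0; have [->|jj0] := eqVneq j j0 => //.
  - have [] := fP j; first by rewrite !inE jj0.
    by rewrite !inE => /andP[/eqP + _] _ e; rewrite -e.
  - have [] := fP i; first by rewrite !inE ij0.
    by rewrite !inE => /andP[/eqP + _] _ e; rewrite -e.
  - by apply: finj; rewrite !inE ?ij0 ?jj0.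
have [->|jj0] := eqVneq j j0; first by rewrite j0a lb.
have [] := fP j; first by rewrite !inE jj0.
by rewrite !inE => /andP[_ ->].
Qed.

(** * Symmetric pencils *)

Lemma cvg_sumr {R : realType} {T I : Type} (F : set_system T) {FF : Filter F}
    (r : seq I) (P : pred I) (f : I -> T -> R) (l : I -> R) :
  (forall i, P i -> f i x @[x --> F] --> l i) ->
  \sum_(i <- r | P i) f i x @[x --> F] --> \sum_(i <- r | P i) l i.
Proof. by apply: cvg_big; exact: add_continuous. Qed.

Section symmetric_pencil.
Variables (R : realType) (N : nat).
Implicit Types (A L M : 'M[R]_N) (x y z : 'rV[R]_N).

Definition bform M x y : R := (x *m M *m y^T) ord0 ord0.

Lemma bformDl M x y z : bform M (x + y) z = bform M x z + bform M y z.
Proof. by rewrite /bform !mulmxDl mxE. Qed.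

Lemma bformDr M x y z : bform M x (y + z) = bform M x y + bform M x z.
Proof. by rewrite /bform linearD mulmxDr mxE. Qed.

Lemma bformZl M a x y : bform M (a *: x) y = a * bform M x y.
Proof. by rewrite /bform -!scalemxAl mxE. Qed.

Lemma bformZr M a x y : bform M x (a *: y) = a * bform M x y.
Proof. by rewrite /bform linearZ -scalemxAr mxE. Qed.

Lemma bformBm A L a x y : bform (A - a *: L) x y = bform A x y - a * bform L x y.
Proof.
by rewrite /bform mulmxBr mulmxBl -scalemxAr -scalemxAl mxE [X in _ + X]mxE [in X in _ + X]mxE.
Qed.

Lemma bformC M x y : M^T = M -> bform M x y = bform M y x.
Proof.
move=> Msym; have -> : bform M x y = (x *m M *m y^T)^T ord0 ord0 by rewrite mxE.
by rewrite !trmx_mul trmxK Msym mulmxA.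
Qed.

Lemma bformE M x y : bform M x y = \sum_i \sum_j x ord0 i * M i j * y ord0 j.
Proof.
rewrite /bform mxE exchange_big /=; apply: eq_bigr => j _; rewrite !mxE big_distrl /=.
by [].
Qed.

Lemma bform_continuous M : continuous (fun x => bform M x x).
Proof.
move=> x; under eq_fun do rewrite bformE.
have nF := nbhs_filter x.
apply: cvg_sumr => i _; apply: cvg_sumr => j _.
apply: cvgM; last exact: coord_continuous.
by apply: cvgM; [exact: coord_continuous|exact: cvg_cst].
Qed.

Lemma psd_quadratic_root (a b : R) : (forall t, 0 <= t * (2 * a) + t ^+ 2 * b) -> a = 0.
Proof.
move=> h; have b1 : 0 < b ^+ 2 + 1 by rewrite ltr_wpDl// sqr_ge0.
have h1 := h 1; have h2 := h (-1).
have b0 : 0 <= b by lra.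
(* Near the minimizer [- a / b]; the [+ 1] keeps the denominator positive when [b = 0], and the
   value is still negative unless [a = 0]. *)
have := h (- a / (b + 1)).
have -> : - a / (b + 1) * (2 * a) + (- a / (b + 1)) ^+ 2 * b = - (a ^+ 2 * ((b + 2) / (b + 1) ^+ 2)).
  by field; lra.
rewrite oppr_ge0 pmulr_lle0; last by rewrite divr_gt0//; [lra|rewrite exprn_gt0//; lra].
by move=> a2; apply/eqP; rewrite -sqrf_eq0 eq_le a2 sqr_ge0.
Qed.

(* Minimize the Rayleigh quotient on the [L]-orthogonal complement of the
   eigenvectors already found. *)
Lemma next_eigenvector A L (m : nat) (V : 'M[R]_(m, N)) (D : 'rV[R]_m) :
  A^T = A -> L^T = L -> (forall x, x != 0 -> 0 < bform L x x) ->
  V *m L *m V^T = 1%:M -> V *m A = diag_mx D *m V *m L -> (m < N)%N ->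
  exists x (a : R), [/\ bform L x x = 1, x *m L *m V^T = 0 & x *m A = a *: (x *m L)].
Proof.
move=> Asym Lsym Lpos VLV VA mN.
pose U := [set x : 'rV[R]_N | x *m L *m V^T = 0].
have UD x y : U x -> U y -> U (x + y).
  by rewrite /U /= !mulmxDl => -> ->; rewrite addr0.
have UZ t x : U x -> U (t *: x) by rewrite /U /= -!scalemxAl => ->; rewrite scaler0.
(* The Rayleigh quotient is homogeneous of degree 0, so it suffices to minimize it on the unit
   sphere of the ambient norm, which is compact. *)
pose S := U `&` [set x : 'rV[R]_N | `|x| = 1].
have S0 : S !=set0.
  have /rowV0Pn[x xker x0] : kermx (L *m V^T) != 0.
    rewrite kermx_eq0 -row_leq_rank -ltnNge.
    exact: leq_ltn_trans (rank_leq_col _) mN.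
  have xn : `|x| != 0 by rewrite normr_eq0.
  exists (`|x|^-1 *: x); split => /=.
    by apply: UZ; rewrite /U /= -mulmxA; exact/sub_kermxP.
  by rewrite normrZ normfV normr_id mulVf.
have cS : compact S.
  apply: bounded_closed_compact.
    exists 1; split; first exact: num_real.
    by move=> M M1 x [_ /= ->]; exact: ltW.
  apply: closedI.
    rewrite (_ : U = \bigcap_(j in [set: 'I_m])
        ((fun x => \sum_i x ord0 i * (L *m V^T) i j) @^-1` [set 0])).
      apply: closed_bigI => j _; apply: preimage_closed; last exact: closed_eq.
      move=> x _; have nF := nbhs_filter x; apply: cvg_sumr => i _.
      by apply: cvgM; [exact: coord_continuous|exact: cvg_cst].
    apply/seteqP; split => [x Ux j _|x Ux].
      have /rowP/(_ j) : x *m (L *m V^T) = 0 by rewrite mulmxA.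
      by rewrite mxE [RHS]mxE.
    rewrite /U /= -mulmxA; apply/rowP => j; rewrite mxE [RHS]mxE.
    exact: (Ux j I).
  rewrite (_ : [set x | _] = (fun y : 'rV[R]_N => `|y|) @^-1` [set 1]) //.
  apply: preimage_closed; last exact: closed_eq.
  by move=> x _; exact: norm_continuous.
pose f x := bform A x x / bform L x x.
have cf : {within S, continuous f}.
  apply: continuous_in_subspaceT => x /set_mem[_ nx].
  have x0 : x != 0 by rewrite -normr_eq0 nx oner_eq0.
  apply: (cvgM (bform_continuous A x) (cvgV _ (bform_continuous L x))).
  by rewrite gt_eqF// Lpos.
have [c] := compact_EVT_min S0 cS cf; rewrite inE => -[Uc nc] cmin.
have c0 : c != 0 by rewrite -normr_eq0 nc oner_eq0.
pose a := f c; pose M := A - a *: L.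
have Mpsd x : U x -> 0 <= bform M x x.
  move=> Ux; have [->|x0] := eqVneq x 0.
    by rewrite /bform !mul0mx mxE.
  have xn : 0 < `|x| by rewrite normr_gt0.
  have := cmin (`|x|^-1 *: x); rewrite inE => /(_ _)/wrap[].
    split; first exact: UZ.
    by rewrite /= normrZ normfV normr_id mulVf// gt_eqF.
  rewrite /f !bformZl !bformZr -/(f c) -/a bformBm.
  rewrite -mulf_div divff ?mul1r; last by rewrite invr_neq0// gt_eqF.
  rewrite -mulf_div divff ?mul1r; last by rewrite invr_neq0// gt_eqF.
  by rewrite ler_pdivlMr ?Lpos// subr_ge0.
have Mc : bform M c c = 0.
  by rewrite bformBm /a /f divfK ?subrr// gt_eqF// Lpos.
have Msym : M^T = M by rewrite /M linearB linearZ /= Asym Lsym.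
(* The form of [M] is nonnegative on [U] and zero at [c], so its first variation at [c] vanishes
   along [U]. *)
have McU z : U z -> bform M c z = 0.
  move=> Uz; apply: (@psd_quadratic_root _ (bform M z z)) => t.
  have := Mpsd (c + t *: z) (UD _ _ Uc (UZ _ _ Uz)).
  rewrite !(bformDl, bformDr, bformZl, bformZr) Mc (bformC M z c Msym).
  by congr (_ <= _); ring.
have McV : c *m M *m V^T = 0.
  rewrite /M mulmxBr mulmxBl -scalemxAr -scalemxAl Uc scaler0 subr0.
  rewrite -mulmxA -[A]Asym -trmx_mul VA !trmx_mul Lsym tr_diag_mx !mulmxA.
  by rewrite (Uc : c *m L *m V^T = 0) mul0mx.
have McE : c *m M = 0.
  apply/rowP => i; pose z : 'rV[R]_N := delta_mx ord0 i.
  have -> : (c *m M) ord0 i = bform M c z.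
    by rewrite /bform trmx_delta -colE [RHS]mxE.
  (* The subtracted term is the [L]-orthogonal projection of [z] onto the row span of [V]; [McU] and
     [McV] treat the two components. *)
  pose z' := z - z *m L *m V^T *m V.
  have Uz' : U z' by rewrite /U /= /z' 2!mulmxBl -!(mulmxA _ V) -!mulmxA (mulmxA V) VLV mulmx1 subrr.
  have -> : z = z' + z *m L *m V^T *m V by rewrite /z' subrK.
  rewrite bformDr McU// add0r /bform trmx_mul mulmxA McV mul0mx.
  by rewrite !mxE.
have cL := Lpos _ c0.
exists ((Num.sqrt (bform L c c))^-1 *: c), a; split.
- rewrite bformZl bformZr mulrA -invfM -expr2 sqr_sqrtr ?mulVf ?gt_eqF//.
  exact: ltW.
- exact: UZ.
- move/eqP: McE; rewrite /M mulmxBr subr_eq0 -scalemxAr => /eqP cA.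
  by rewrite -!scalemxAl cA !scalerA mulrC.
Qed.

Lemma pencil_eigenbasis A L : A^T = A -> L^T = L ->
  (forall x, x != 0 -> 0 < bform L x x) ->
  exists (V : 'M[R]_N) (D : 'rV[R]_N),
    V *m L *m V^T = 1%:M /\ V *m A = diag_mx D *m V *m L.
Proof.
move=> Asym Lsym Lpos.
suff H m : (m <= N)%N -> exists (V : 'M[R]_(m, N)) (D : 'rV[R]_m),
    V *m L *m V^T = 1%:M /\ V *m A = diag_mx D *m V *m L by exact: H.
elim: m => [_|m IHm mN].
  by exists 0, 0; split; apply/matrixP => -[].
have [V [D [VLV VA]]] := IHm (ltnW mN).
have [x [a [xLx xLV xA]]] := next_eigenvector A L m V D Asym Lsym Lpos VLV VA mN.
have VLx : V *m L *m x^T = 0.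
  by apply: trmx_inj; rewrite !trmx_mul trmxK Lsym mulmxA xLV trmx0.
rewrite -addn1; exists (col_mx V x), (row_mx D a%:M); split.
  have xLx1 : x *m L *m x^T = 1%:M.
    by rewrite [LHS]mx11_scalar -[_ ord0 ord0]/(bform L x x) xLx.
  rewrite tr_col_mx !mul_col_mx !mul_mx_row VLV xLV VLx xLx1.
  by rewrite -[col_mx _ _]/(block_mx _ _ _ _) -scalar_mx_block.
rewrite diag_mx_row mul_block_col !mul_col_mx VA xA !mul0mx addr0 add0r.
congr col_mx; rewrite -mulmxA; apply/rowP => i; rewrite !mxE big_ord1.
by rewrite !mxE eqxx.
Qed.

(** The columns of [V^T] are eigenvectors of [invmx L *m A], which is therefore similar to
    [diag_mx D]. *)
Lemma char_poly_pencil A L (V : 'M[R]_N) (D : 'rV[R]_N) : A^T = A -> L^T = L ->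
  V *m L *m V^T = 1%:M -> V *m A = diag_mx D *m V *m L ->
  char_poly (invmx L *m A) = \prod_i ('X - (D ord0 i)%:P).
Proof.
move=> Asym Lsym VLV VA.
have Vu : V^T \in unitmx by apply: (mulmx1_unit VLV).2.
have Lu : L \in unitmx.
  by have := (mulmx1_unit VLV).1; rewrite unitmx_mul => /andP[].
have eqA : invmx L *m A *m V^T = V^T *m diag_mx D.
  rewrite -mulmxA -[X in X *m V^T]Asym -trmx_mul VA !trmx_mul tr_diag_mx Lsym.
  by rewrite mulKmx.
have -> : invmx L *m A = V^T *m diag_mx D *m invmx V^T by rewrite -eqA mulmxK.
have <- : char_poly (diag_mx D) = \prod_i ('X - (D ord0 i)%:P).
  rewrite char_poly_trig ?diag_mx_is_trig//.
  by apply: eq_bigr => i _; rewrite mxE eqxx.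
rewrite /char_poly /char_poly_mx.
have -> : 'X%:M - map_mx polyC (V^T *m diag_mx D *m invmx V^T) =
    map_mx polyC V^T *m ('X%:M - map_mx polyC (diag_mx D)) *m map_mx polyC (invmx V^T).
  rewrite mulmxBr mulmxBl !map_mxM; congr (_ - _).
  by rewrite scalar_mxC -mulmxA -map_mxM mulmxV// map_mx1 mulmx1.
rewrite !det_mulmx mulrAC -det_mulmx -map_mxM mulmxV// map_mx1 det1 mul1r.
by [].
Qed.



(** The weights may be nonpositive where [u] vanishes: in the application these are the indices of
    the eigenvalues inside [[c, d]]. *)
Lemma sum_sqr_eq0 (u e : 'rV[R]_N) :
  (forall s, u ord0 s != 0 -> 0 < e ord0 s) ->
  \sum_s u ord0 s ^+ 2 * e ord0 s <= 0 -> u = 0.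
Proof.
move=> e0; have ge0 s : true -> 0 <= u ord0 s ^+ 2 * e ord0 s.
  have [->|us _] := eqVneq (u ord0 s) 0; first by rewrite expr0n mul0r.
  by rewrite mulr_ge0 ?sqr_ge0// ltW// e0.
rewrite le_eqVlt ltNge sumr_ge0// orbF => /eqP s0; have h := psumr_eq0P ge0 s0.
apply/rowP => s; rewrite mxE; apply/eqP; apply/negPn/negP => us.
have /eqP := h s isT; rewrite mulf_eq0 sqrf_eq0 (negbTE us) /=.
by rewrite gt_eqF// e0.
Qed.

(** One equation per element of [S] and one unknown per element of [J]: the linear system is
    underdetermined. The matrix [E] extends a vector indexed by [J] by zero. *)
Lemma exists_supported_kernel (G : 'M[R]_N) (J S : {set 'I_N}) : (#|S| < #|J|)%N ->
  exists w : 'rV[R]_N, [/\ w != 0, forall j, j \notin J -> w ord0 j = 0 &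
    forall s, s \in S -> (w *m G) ord0 s = 0].
Proof.
move=> SJ.
pose E := \matrix_(p < #|J|, j < N) (enum_val p == j)%:R : 'M[R]_(#|J|, N).
pose Q := \matrix_(p < #|J|, q < #|S|) G (enum_val p) (enum_val q).
have EG p s : (E *m G) p s = G (enum_val p) s.
  rewrite mxE (bigD1 (enum_val p))//= mxE eqxx mul1r big1 ?addr0// => j jp.
  by rewrite mxE eq_sym (negbTE jp) mul0r.
have /rowV0Pn[y yker y0] : kermx Q != 0.
  by rewrite kermx_eq0 -row_leq_rank -ltnNge (leq_ltn_trans (rank_leq_col _)).
have yE p : (y *m E) ord0 (enum_val p) = y ord0 p.
  rewrite mxE (bigD1 p)//= mxE eqxx mulr1 big1 ?addr0// => q qp.
  by rewrite mxE (inj_eq enum_val_inj) (negbTE qp) mulr0.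
exists (y *m E); split.
- apply: contraNneq y0 => yE0; apply/eqP/rowP => p.
  by rewrite -yE yE0 !mxE.
- move=> j jJ; rewrite mxE big1// => p _; rewrite mxE.
  have [pj|] := eqVneq (enum_val p) j; last by rewrite mulr0.
  by move: jJ; rewrite -pj enum_valP.
- move=> s sS; have yQ : y *m Q = 0 by exact/sub_kermxP.
  transitivity ((y *m Q) ord0 (enum_rank_in sS s)); last by rewrite yQ mxE.
  rewrite -mulmxA mxE [RHS]mxE; apply: eq_bigr => p _.
  by rewrite EG !mxE enum_rankK_in.
Qed.

(* On vectors supported on [J], the operator [invmx L *m A - (c + d) / 2] has
   [L]-norm at most [(d - c) / 2], while it is strictly expanding by that
   factor on the span of the eigenvectors with eigenvalue outside [c, d]. *)
Lemma count_eigenvalues A L (V : 'M[R]_N) (D : 'rV[R]_N) (a b : 'I_N -> R) :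
  V *m L *m V^T = 1%:M -> V *m A = diag_mx D *m V *m L ->
  (forall j, a j <= b j) ->
  (forall (c d : R) (w z : 'rV[R]_N),
    (forall j, w ord0 j != 0 -> c <= a j /\ b j <= d) ->
    2 * bform (A - ((c + d) / 2) *: L) w z <=
    ((d - c) / 2) ^+ 2 * bform L w w + bform L z z) ->
  forall c d : R, (#|[set j | (c <= a j)%R && (b j <= d)%R]%SET| <=
                   #|[set s | (c <= D ord0 s <= d)%R]%SET|)%N.
Proof.
move=> VLV VA ab AL c d; rewrite leqNgt; apply/negP => SJ.
have cd : c <= d.
  have /card_gt0P[j] := leq_ltn_trans (leq0n _) SJ.
  by rewrite inE => /andP[ca bd]; rewrite (le_trans ca)// (le_trans (ab j)).
have [w [w0 wJ wS]] := exists_supported_kernel (L *m V^T) _ _ SJ.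
pose u := w *m (L *m V^T).
have wE : w = u *m V.
  by rewrite /u -mulmxA (mulmx1C (_ : V *m (L *m V^T) = 1%:M)) ?mulmx1// mulmxA.
pose m := (c + d) / 2; pose e : 'rV[R]_N := \row_s (D ord0 s - m).
(* In the eigenvector basis, this is the image of [w] under the shifted operator, which turns the
   mixed term [bform (A - m *: L) w z] into [bform L z z]. *)
pose z := u *m diag_mx e *m V.
have eE : diag_mx e = diag_mx D - m%:M.
  by apply/matrixP => i j; rewrite !mxE; case: (i == j); rewrite ?mulr0n ?subr0.
have wz : w *m (A - m *: L) = z *m L.
  rewrite wE /z -(mulmxA u) mulmxBr VA -scalemxAr -(mulmxA _ V L).
  by rewrite -[X in _ - X]mul_scalar_mx -mulmxBl eE !mulmxA.
have zz : bform L z z = \sum_s u ord0 s ^+ 2 * e ord0 s ^+ 2.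
  have -> : bform L z z = ((u *m diag_mx e) *m (u *m diag_mx e)^T) ord0 ord0.
    rewrite /bform /z [in X in _ *m X]trmx_mul !mulmxA -(mulmxA _ V L).
    by rewrite -(mulmxA _ (V *m L)) VLV mulmx1.
  rewrite mxE; apply: eq_bigr => s _; rewrite mul_mx_diag !mxE.
  by rewrite mulrACA -!expr2.
have ww : bform L w w = \sum_s u ord0 s ^+ 2.
  have -> : bform L w w = (u *m u^T) ord0 ord0.
    rewrite /bform wE trmx_mul !mulmxA -(mulmxA _ V L).
    by rewrite -(mulmxA _ (V *m L)) VLV mulmx1.
  by rewrite mxE; apply: eq_bigr => s _; rewrite !mxE expr2.
have : 2 * bform (A - m *: L) w z <= ((d - c) / 2) ^+ 2 * bform L w w + bform L z z.
  apply: AL => j wj; have := contraR (fun h => introT eqP (wJ j h)) wj.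
  by rewrite inE => /andP[].
have -> : bform (A - m *: L) w z = bform L z z by rewrite /bform wz.
rewrite mulr_natl mulr2n lerD2r -subr_le0 zz ww mulr_sumr -sumrB => le0.
have u0 : u = 0.
  (* The inequality weights the squared coordinates of [u] by
     [(D ord0 s - m) ^+ 2 - ((d - c) / 2) ^+ 2]. This factors as [(D ord0 s - c) * (D ord0 s - d)],
     which is positive exactly outside [[c, d]]. *)
  apply: (sum_sqr_eq0 _ (\row_s ((D ord0 s - c) * (D ord0 s - d)))); last first.
    apply: le_trans le0; rewrite le_eqVlt; apply/orP; left; apply/eqP.
    by apply: eq_bigr => s _; rewrite !mxE /m; field.
  move=> s us; rewrite mxE; have /negP := contraNN (fun h => introT eqP (wS s h)) us.
  rewrite inE => /negP; rewrite negb_and -!ltNge => /orP[Dc|dD].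
    by rewrite nmulr_rgt0 subr_lt0 ?(lt_le_trans Dc cd).
  by rewrite pmulr_rgt0 subr_gt0 ?(le_lt_trans cd dD).
by move: w0; rewrite wE u0 mul0mx eqxx.
Qed.

Lemma pencil_ordered_positive_spectrum A L : A^T = A -> L^T = L ->
  (forall x, x != 0 -> 0 < bform A x x) -> (forall x, x != 0 -> 0 < bform L x x) ->
  exists lam : 'I_N -> R, ordered_positive_spectrum (invmx L *m A) lam.
Proof.
move=> Asym Lsym Apos Lpos.
have [V [D [VLV VA]]] := pencil_eigenbasis A L Asym Lsym Lpos.
have D0 s : 0 < D ord0 s.
  have VAV : V *m A *m V^T = diag_mx D by rewrite VA -!mulmxA (mulmxA V) VLV mulmx1.
  have -> : D ord0 s = bform A (row s V) (row s V).
    transitivity ((V *m A *m V^T) s s); first by rewrite VAV mxE eqxx.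
    rewrite /bform -!row_mul mxE [RHS]mxE [RHS]mxE.
    by apply: eq_bigr => j _; rewrite !mxE.
  apply: Apos; apply/eqP => Vs0.
  have /rowP/(_ s) : row s (V *m L *m V^T) = 0 by rewrite !row_mul Vs0 !mul0mx.
  by rewrite VLV !mxE eqxx => /eqP; rewrite oner_eq0.
pose t := sort <=%R [seq D ord0 s | s <- enum 'I_N].
have szt : size t = N by rewrite size_sort size_map size_enum_ord.
exists (fun i => t`_i); split.
- move=> i; have : t`_i \in t by rewrite mem_nth// szt.
  by rewrite mem_sort => /mapP[s _ ->].
- move=> i j ij; apply: (sorted_leq_nth le_trans le_refl) => //; rewrite ?inE ?szt//.
  by apply: sort_sorted; exact: le_total.
- rewrite (char_poly_pencil A L V D)//.
  transitivity (\prod_(x <- t) ('X - x%:P)).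
    rewrite (perm_big [seq D ord0 s | s <- enum 'I_N]); last by rewrite /= perm_sort.
    by rewrite big_map big_enum.
  by rewrite (big_nth 0) szt big_mkord.
Qed.

Lemma pencil_matching A L (a b : 'I_N -> R) : A^T = A -> L^T = L ->
  (forall x, x != 0 -> 0 < bform L x x) -> (forall j, a j <= b j) ->
  (forall (c d : R) (w z : 'rV[R]_N),
    (forall j, w ord0 j != 0 -> c <= a j /\ b j <= d) ->
    2 * bform (A - ((c + d) / 2) *: L) w z <=
    ((d - c) / 2) ^+ 2 * bform L w w + bform L z z) ->
  forall lam : 'I_N -> R, ordered_positive_spectrum (invmx L *m A) lam ->
  exists pi : 'S_N, forall j, a j <= lam (pi j) <= b j.
Proof.
move=> Asym Lsym Lpos ab AL lam [_ _ charlam].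
have [V [D [VLV VA]]] := pencil_eigenbasis A L Asym Lsym Lpos.
(* Both tuples list the roots of the same split polynomial. *)
have : perm_eq [tuple D ord0 s | s < N] [tuple lam s | s < N].
  apply: prod_XsubC_eq; rewrite !big_tuple.
  under eq_bigr do rewrite tnth_mktuple.
  under [RHS]eq_bigr do rewrite tnth_mktuple.
  by rewrite -(char_poly_pencil A L V D).
case/tuple_permP => p /val_inj pE.
have lamE s : D ord0 s = lam (p s).
  by have /(congr1 (fun t => tnth t s)) := pE; rewrite !tnth_mktuple.
have [f [finj fP]] : exists f : 'I_N -> 'I_N, {in [set: 'I_N]%SET &, injective f} /\
    forall j, j \in [set: 'I_N]%SET -> f j \in [set: 'I_N]%SET /\ a j <= D ord0 (f j) <= b j.
  apply: (interval_matching _ _ (D ord0) N); rewrite ?cardsT ?card_ord// => c d.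
  have := count_eigenvalues A L V D a b VLV VA ab AL c d.
  congr (_ <= _)%N; apply: eq_card => i; rewrite !inE //.
have {}finj : injective f by move=> i j; apply: finj; rewrite inE.
exists (perm finj * p)%g => j; rewrite permM permE -lamE.
by have [] := fP j; rewrite ?inE.
Qed.

End symmetric_pencil.

(** * Lebesgue integration on row vectors *)

Section integral_off_null_sets.
Context {d} {T : measurableType d} {R : realType} (mu : {measure set T -> \bar R}).
Implicit Types (f g : T -> \bar R) (D E N : set T).

Import HBNNSimple.

(** The integral of a nonnegative function is a supremum over the simple functions below it, and
    cutting such a function off on [N] does not change its integral. The statement thus covers
    integrands that are Borel only off a null set, like those built from [k]. *)
Lemma ge0_le_integral_off_null N f g : measurable N -> mu N = 0%E ->
  (forall x, (0 <= f x)%E) -> (forall x, (0 <= g x)%E) ->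
  (forall x, ~ N x -> (f x <= g x)%E) ->
  (\int[mu]_x f x <= \int[mu]_x g x)%E.
Proof.
move=> mN N0 f0 g0 fg; rewrite !ge0_integralTE//.
apply: ge_ereal_sup => /= _ [h hf <-].
have mNC : measurable (~` N) by exact: measurableC.
pose h' := proj_nnsfun h mNC.
have -> : sintegral mu h = sintegral mu h'.
  rewrite -!integralT_nnsfun; apply: ae_eq_integral => //.
  - exact/measurable_EFinP.
  - exact/measurable_EFinP.
  - exists N; split => // x /= hx; apply: contrapT => Nx; apply: hx => _ /=.
    by rewrite /mindic indicE mem_set//= mulr1.
apply: ereal_sup_ubound; exists h' => // x.
rewrite /h' /= /mindic indicE; have [Nx|Nx] := pselect (N x).
  by rewrite memNset/= ?mulr0//; exact.
by rewrite mem_set//= mulr1 (le_trans (hf x))// fg.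
Qed.

Lemma eq_integral_off_null N D E f g : measurable N -> mu N = 0%E ->
  (forall x, ~ N x -> (f \_ D) x = (g \_ E) x) ->
  (\int[mu]_(x in D) f x = \int[mu]_(x in E) g x)%E.
Proof.
move=> mN N0 fg; rewrite (integral_mkcond D) (integral_mkcond E).
rewrite integralE [RHS]integralE; congr (_ - _)%E; apply/le_anti/andP; split;
  apply: (ge0_le_integral_off_null N) => // x Nx;
  by rewrite ?funeposE ?funenegE (fg x).
Qed.

Lemma integral_off_negligible D E f : E `<=` D -> mu.-negligible (D `\` E) ->
  (\int[mu]_(x in D) f x = \int[mu]_(x in E) f x)%E.
Proof.
move=> ED [N [mN N0 DEN]]; apply: (eq_integral_off_null N) => // x Nx.
rewrite !patchE; have [xE|xE] := boolP (x \in E).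
  by rewrite (mem_set (ED _ (set_mem xE))).
case: ifPn => // /set_mem xD; exfalso; apply: Nx; apply: DEN; split => //.
by move=> Ex; move: xE; rewrite mem_set.
Qed.

Lemma negligible_bigcup_seq (I : eqType) (s : seq I) (A : I -> set T) :
  (forall i, i \in s -> mu.-negligible (A i)) ->
  mu.-negligible (\bigcup_(i in [set` s]) A i).
Proof.
elim: s => [_|i s IHs As].
  by apply: negligibleS (negligible_set0 mu) => x [].
apply: negligibleS (negligibleU (As i _) (IHs _)) => [x [j /=]||j js].
- by rewrite inE => /orP[/eqP ->|js] Ax; [left|right; exists j].
- by rewrite inE eqxx.
- by apply: As; rewrite inE js orbT.
Qed.

End integral_off_null_sets.

Section rV_topology_measure.
Context {R : realType}.

Lemma rV_ballP n (x y : 'rV[R]_n) (r : R) : 0 < r ->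
  ball x r y <-> forall i, `|x ord0 i - y ord0 i| < r.
Proof.
move=> r0; split => [[_ h] i|h]; first exact: (h ord0 i).
by split => // i j; rewrite ord1; exact: h.
Qed.

Lemma measurable_rV_box n (D : 'I_n -> set (measurableTypeR R)) :
  (forall i, measurable (D i)) ->
  measurable [set y : 'rV[R]_n | forall i, D i (y ord0 i)].
Proof.
move=> mD; rewrite (_ : mkset _ =
  \bigcap_(i in [set: 'I_n]) ((fun y : 'rV[R]_n => y ord0 i : measurableTypeR R) @^-1` D i)).
  apply: fin_bigcap_measurable; first exact: finite_finset.
  by move=> i _; rewrite -[X in measurable X]setTI; exact: measurable_coord.
by apply/seteqP; split => [y h i _|y h i]; [exact: h|exact: (h i I)].
Qed.

Lemma measurable_rV_ball n (x : 'rV[R]_n) (r : R) : 0 < r -> measurable (ball x r).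
Proof.
move=> r0; rewrite (_ : ball x r = [set y : 'rV[R]_n | forall i, (ball (x ord0 i) r : set R) (y ord0 i)]).
  by apply: (measurable_rV_box n (fun i => ball (x ord0 i) r)) => i; exact: measurable_ball.
by apply/seteqP; split => y; rewrite (rV_ballP _ _ _ _ r0).
Qed.

(** Balls of the max norm are boxes, hence measurable, and those with rational centres and radii
    [k.+1%:R^-1] form a countable base. *)
Lemma open_measurable_rV n (U : set 'rV[R]_n) : open U -> measurable U.
Proof.
move=> oU.
pose B (p : 'rV[rat]_n * nat) : set 'rV[R]_n := ball (map_mx ratr p.1 : 'rV[R]_n) p.2.+1%:R^-1.
have -> : U = \bigcup_(p in [set p | B p `<=` U]) B p.
  apply/seteqP; split => [x Ux|x [p /= pU] /pU//].
  have := oU; rewrite openE => /(_ _ Ux)/nbhs_ballP[e /= e0 eU].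
  have [k ke] : exists k, k.+1%:R^-1 < e / 2 :> R.
    exists (Num.truncn (e / 2)^-1); rewrite invf_plt ?posrE ?divr_gt0//.
    exact: truncnS_gt.
  have k0 : 0 < k.+1%:R^-1 :> R by rewrite invr_gt0.
  have /choice[q qP] i : exists q : rat, `|ratr q - x ord0 i| < k.+1%:R^-1.
    have xx : x ord0 i - k.+1%:R^-1 < x ord0 i + k.+1%:R^-1.
      by rewrite ltrBlDr -addrA ltrDl addr_gt0.
    have [q] := rat_in_itvoo xx.
    by rewrite in_itv /= => /andP[q1 q2]; exists q; rewrite ltr_distl q1 q2.
  exists (\row_i q i, k) => /=; last first.
    by apply/rV_ballP => // i; rewrite !mxE.
  move=> y /rV_ballP-/(_ k0) h; apply: eU; apply/rV_ballP => // i.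
  have := h i; rewrite !mxE /= => hi; have := qP i => qi.
  apply: le_lt_trans (ler_distD (ratr (q i)) _ _) _.
  by rewrite distrC [e]splitr ltrD// (lt_trans _ ke).
rewrite bigcup_mkcond; apply: countable_bigcupT_measurable => // p.
by case: ifPn => // _; apply: measurable_rV_ball; rewrite invr_gt0.
Qed.

(** Through [rV_cons], a ball is the product of an interval and a ball one dimension lower; in
    dimension 0 the measure is a Dirac mass. *)
Lemma lebesgue_rV_ball n (x : 'rV[R]_n) (r : R) : 0 < r ->
  (0 < lebesgue_rV n (ball x r) < +oo)%E.
Proof.
move=> r0; elim: n x => [|n IHn] x.
  rewrite /= diracE mem_set ?lte01 ?ltry//.
  by apply/rV_ballP => // -[].
rewrite /= /lebesgue_rV_step /pushforward.
have -> : @rV_cons R n @^-1` ball x r =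
    ball (x ord0 ord0) r `*` ball (rV_uncons x).2 r.
  apply/seteqP; split => -[t v] /=.
    move=> /rV_ballP-/(_ r0) h; split; first by have := h ord0; rewrite rV_cons0.
    by apply/rV_ballP => // i; have := h (lift ord0 i); rewrite rV_consS mxE.
  move=> [h0 /rV_ballP-/(_ r0) h]; apply/rV_ballP => // i.
  case: (unliftP ord0 i) => [j ->|->]; last by rewrite rV_cons0.
  by have := h j; rewrite rV_consS mxE.
have mb := measurable_rV_ball _ (rV_uncons x).2 _ r0.
have /andP[h1 h2] := IHn (rV_uncons x).2.
rewrite product_measure1E//; last exact: measurable_ball.
set l := (X in (X * _)%E).
have -> : l = (r *+ 2)%:E by exact: lebesgue_measure_ball (ltW r0).
have r2 : 0 < r *+ 2 by rewrite mulrn_wgt0.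
rewrite mule_gt0//= lte_mul_pinfty// ?lee_fin; first exact: ltW.
Qed.

Lemma lebesgue_rV_bounded n (D : set 'rV[R]_n) : measurable D -> bounded_set D ->
  (lebesgue_rV n D < +oo)%E.
Proof.
move=> mD [M [_ MD]]; pose r := `|M| + 2.
have r0 : 0 < r by rewrite /r ltr_wpDl.
have /andP[_] := lebesgue_rV_ball n 0 r r0; apply: le_lt_trans.
apply: le_measure; rewrite ?inE//; first exact: measurable_rV_ball.
move=> x Dx; have := MD (`|M| + 1) _ x Dx; rewrite (le_lt_trans (ler_norm M)) ?ltrDl// => /(_ isT) xM.
by rewrite -ball_normE /ball_ /= sub0r normrN (le_lt_trans xM)// /r ltrD2l ltr1n.
Qed.

Lemma lebesgue_rV_open_gt0 n (U : set 'rV[R]_n) : open U -> U !=set0 ->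
  (0 < lebesgue_rV n U)%E.
Proof.
move=> oU [x Ux]; have := oU; rewrite openE => /(_ _ Ux)/nbhs_ballP[e /= e0 eU].
have /andP[+ _] := lebesgue_rV_ball n x e e0; move/lt_le_trans; apply.
by apply: le_measure => //; rewrite inE; [exact: measurable_rV_ball|exact: open_measurable_rV].
Qed.

Lemma continuous_measurable_rV n (E : set 'rV[R]_n) (f : 'rV[R]_n -> R) :
  open E -> {in E, continuous f} -> measurable_fun E f.
Proof.
move=> oE cf; apply: (measurability _ (RGenOpens.measurableE R)).
move=> _ [_ [a [b ->]] <-]; apply: open_measurable_rV; rewrite openE => x [Ex fx].
have Enb : nbhs x E by exact: open_nbhs_nbhs.
apply: filterI => //; have := cf x (mem_set Ex); apply.
by apply: open_nbhs_nbhs; split => //; exact: interval_open.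
Qed.

End rV_topology_measure.

(** * Polynomial functions *)

Section polynomial_functions.
Context {R : realType} {n : nat}.
Implicit Types f : 'rV[R]_n -> R.

Lemma meval_fun_ind (P : ('rV[R]_n -> R) -> Prop) :
  (forall c, P (fun=> c)) -> (forall i, P (fun x => x ord0 i)) ->
  (forall f g, P f -> P g -> P (fun x => f x + g x)) ->
  (forall f g, P f -> P g -> P (fun x => f x * g x)) ->
  forall p : mpoly.mpoly n R, P (fun x => mpoly.meval (fun l => x ord0 l) p).
Proof.
move=> Pc Px PD PM p; under eq_fun do rewrite mpoly.mevalE.
elim: (mpoly.msupp p) => [|m s IHs]; first by under eq_fun do rewrite big_nil.
under eq_fun do rewrite big_cons.
  apply: (PD) => //; apply: (PM) => //.
elim: (index_enum _) => [|i t IHt]; first by under eq_fun do rewrite big_nil.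
under eq_fun do rewrite big_cons.
  apply: (PM) => //.
elim: (_ i) => [|k IHk]; first by under eq_fun do rewrite expr0.
under eq_fun do rewrite exprS.
exact: (PM).
Qed.

Lemma is_derive_coord (i l : 'I_n) (x : 'rV[R]_n) :
  is_derive x (delta_mx ord0 l) (fun y : 'rV[R]_n => y ord0 i) (i == l)%:R.
Proof.
apply: DeriveDef; first exact/diff_derivable/differentiable_coord.
rewrite /derive; apply: cvg_lim => //; apply: cvg_near_cst; near=> h.
have h0 : h != 0 by near: h; exact: nbhs_dnbhs_neq.
by rewrite /= !mxE eqxx /= addrK [_ *: _]mulrA mulVf// mul1r.
Unshelve. all: by end_near. Qed.

(* The last clause says that [f] is polynomial along lines, with the
   derivative given by the chain rule. *)
Definition poly_fun f (df : 'I_n -> 'rV[R]_n -> R) : Prop :=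
  [/\ continuous f, forall l, continuous (df l),
      forall x l, is_derive x (delta_mx ord0 l) f (df l x) &
      forall x y, exists q : {poly R}, forall t, q.[t] = f (x + t *: y) /\
        q^`().[t] = \sum_l y ord0 l * df l (x + t *: y)].

Lemma poly_fun_meval (p : mpoly.mpoly n R) :
  exists df, poly_fun (fun x => mpoly.meval (fun l => x ord0 l) p) df.
Proof.
apply: (meval_fun_ind (fun f => exists df, poly_fun f df)).
- move=> c; exists (fun _ _ => 0); split.
  + exact: cst_continuous.
  + by move=> l; exact: cst_continuous.
  + by move=> x l; exact: is_derive_cst.
  + move=> x y; exists c%:P => t; rewrite hornerC derivC horner0; split => //.
    by rewrite big1// => i _; rewrite mulr0.
- move=> i; exists (fun l _ => (i == l)%:R); split.
  + exact: coord_continuous.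
  + by move=> l; exact: cst_continuous.
  + by move=> x l; exact: is_derive_coord.
  + move=> x y; exists ((x ord0 i)%:P + (y ord0 i)%:P * 'X) => t; split.
      by rewrite !hornerE !mxE mulrC.
    rewrite derivD derivC add0r derivM derivC mul0r add0r derivX mulr1 hornerC.
    rewrite (bigD1 i)//= eqxx mulr1 big1 ?addr0// => l li.
    by rewrite eq_sym (negbTE li) mulr0.
- move=> f g [df [cf cdf Df lf]] [dg [cg cdg Dg lg]].
  exists (fun l x => df l x + dg l x); split.
  + by move=> x; exact: (cvgD (cf x) (cg x)).
  + by move=> l x; exact: (cvgD (cdf l x) (cdg l x)).
  + by move=> x l; exact: is_deriveD.
  + move=> x y; have [p' pE] := lf x y; have [q qE] := lg x y.
    exists (p' + q) => t; have [p1 p2] := pE t; have [q1 q2] := qE t.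
    rewrite derivD !hornerD p1 q1 p2 q2; split => //.
    by rewrite -big_split; apply: eq_bigr => l _; rewrite mulrDr.
- move=> f g [df [cf cdf Df lf]] [dg [cg cdg Dg lg]].
  exists (fun l x => f x * dg l x + g x * df l x); split.
  + by move=> x; exact: (cvgM (cf x) (cg x)).
  + move=> l x; exact: (cvgD (cvgM (cf x) (cdg l x)) (cvgM (cg x) (cdf l x))).
  + by move=> x l; exact: is_deriveM.
  + move=> x y; have [p' pE] := lf x y; have [q qE] := lg x y.
    exists (p' * q) => t; have [p1 p2] := pE t; have [q1 q2] := qE t.
    rewrite derivM hornerD !hornerM p1 q1 p2 q2; split => //.
    rewrite mulr_suml mulr_sumr -big_split; apply: eq_bigr => l _ /=.
    by ring.
Qed.

Lemma poly_fun_sum (I : Type) (r : seq I) (c : I -> R) (f : I -> 'rV[R]_n -> R) df :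
  (forall i, poly_fun (f i) (df i)) ->
  poly_fun (fun x => \sum_(i <- r) c i * f i x)
    (fun l x => \sum_(i <- r) c i * df i l x).
Proof.
move=> fP; elim: r => [|i r [cg cdg Dg lg]].
  under eq_fun do rewrite big_nil.
  under [X in poly_fun _ X]eq_fun do under eq_fun do rewrite big_nil.
  split; [exact: cst_continuous|by move=> l; exact: cst_continuous| |].
    by move=> x l; exact: is_derive_cst.
  move=> x y; exists 0 => t; rewrite deriv0 !horner0; split => //.
  by rewrite big1// => l _; rewrite mulr0.
have [cf cdf Df lf] := fP i.
under eq_fun do rewrite big_cons.
under [X in poly_fun _ X]eq_fun do under eq_fun do rewrite big_cons.
split.
- by move=> x; exact: (cvgD (cvgM (cvg_cst (c i)) (cf x)) (cg x)).
- by move=> l x; exact: (cvgD (cvgM (cvg_cst (c i)) (cdf l x)) (cdg l x)).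
- move=> x l; have [D1 D2] := is_deriveD (is_deriveZ (c i) (Df x l)) (Dg x l).
  by apply: DeriveDef; [exact: D1|rewrite [LHS]D2].
- move=> x y; have [p pE] := lf x y; have [q qE] := lg x y.
  exists (c i *: p + q) => t; have [p1 p2] := pE t; have [q1 q2] := qE t.
  rewrite derivD derivZ !hornerD !hornerZ p1 q1 p2 q2; split => //.
  rewrite mulr_sumr -big_split; apply: eq_bigr => l _ /=.
  by rewrite mulrDr mulrCA.
Qed.

(** On a line through a point of [U], the derivative is a polynomial in one variable that vanishes
    on a whole segment, hence is zero. This is why the conclusion reaches beyond [U]. *)
Lemma poly_fun_constant f df (U : set 'rV[R]_n) : poly_fun f df ->
  open U -> U !=set0 -> (forall l x, U x -> df l x = 0) ->
  forall x y, f x = f y.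
Proof.
move=> [_ _ _ lf] oU [x Ux] df0.
suff fx y : f y = f x by move=> y z; rewrite fx [RHS]fx.
have [q qE] := lf x (y - x).
have [e e0 eU] : exists2 e : R, 0 < e & ball x e `<=` U.
  by have := oU; rewrite openE => /(_ _ Ux)/nbhs_ballP.
(* For [0 < t <= d] the point [x + t *: (y - x)] stays in the ball; the [+ 1] covers the case
   [y = x]. *)
pose d := e / (`|y - x| + 1).
have yx1 : 0 < `|y - x| + 1 by rewrite ltr_wpDl.
have d0 : 0 < d by rewrite divr_gt0.
have q'0 t : 0 < t <= d -> root q^`() t.
  move=> /andP[t0 td]; apply/rootP; have [_ ->] := qE t; rewrite big1// => l _.
  rewrite df0 ?mulr0//; apply: eU; rewrite -ball_normE /ball_ /= opprD addNKr normrN.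
  rewrite normrZ gtr0_norm//; apply: (@le_lt_trans _ _ (d * `|y - x|)).
    by rewrite ler_wpM2r.
  by rewrite /d mulrAC ltr_pdivrMr// ltr_pM2l// ltrDl.
have {}q'0 : q^`() = 0.
  pose r := [seq d / k.+1%:R | k <- iota 0 (size q^`())].
  apply: (@roots_geq_poly_eq0 _ _ r).
  - apply/allP => _ /mapP[k _ ->]; apply: q'0.
    by rewrite divr_gt0//= ler_pdivrMr// ler_peMr ?ler1n// ltW.
  - rewrite map_inj_uniq ?iota_uniq// => i j /(mulfI (lt0r_neq0 d0)) /invr_inj.
    by move/eqP; rewrite eqr_nat => /eqP[].
  - by rewrite size_map size_iota.
have : (size q <= 1)%N.
  apply/leq_sizeP => -[//|i] _; apply/eqP.
  by have /eqP := congr1 (fun p : {poly R} => p`_i) q'0; rewrite coef_deriv coef0 mulrn_eq0.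
move=> /size1_polyC qC.
have [q1 _] := qE 1; have [q0 _] := qE 0.
move: q1 q0; rewrite qC !hornerC => ->; rewrite scale0r addr0 => <-.
by rewrite scale1r addrC subrK.
Qed.

End polynomial_functions.

(** * Functions in H^1_0 with finitely many values *)

(** Integrating [g'] from [- B], where [g] vanishes, bounds [g] everywhere by the integral of
    [|g'|]; the factor [2 * B] is the length of the interval outside which [g] is zero. *)
Lemma poincare_line {R : realType} (g g' : R -> R) (B : R) : 0 < B ->
  (forall t, is_derive t (1 : R) g (g' t)) -> continuous g' ->
  (forall t, B <= `|t| -> g t = 0) ->
  (\int[@lebesgue_measure R]_t `|g t|%:E <=
   (2 * B)%:E * \int[@lebesgue_measure R]_t `|g' t|%:E)%E.
Proof.
move=> B0 Dg cg' g0; pose I := (\int[@lebesgue_measure R]_t `|g' t|%:E)%E; rewrite -/I.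
have cg : continuous g.
  move=> y; apply: differentiable_continuous; apply/derivable1_diffP.
  exact: (@ex_derive _ _ _ _ _ _ _ (Dg y)).
have mg' : measurable_fun setT g' by exact: continuous_measurable_fun.
have mg : measurable_fun setT g by exact: continuous_measurable_fun.
have m_g' D : measurable D -> measurable_fun D (fun t => `|g' t|%:E).
  move=> mD; apply/measurable_EFinP; apply: measurableT_comp => //.
  exact: measurable_funS mg'.
have gI t : (`|g t|%:E <= I)%E.
  have [tB|Bt] := leP B `|t|.
    by rewrite g0// normr0; apply: integral_ge0 => s _; rewrite lee_fin.
  have Bt' : - B < t by move: Bt; rewrite ltr_norml => /andP[].
  have FTC : (\int[@lebesgue_measure R]_(s in `[(- B)%R, t]) (g' s)%:E = (g t)%:E)%E.
    rewrite (continuous_FTC2 Bt' (F := g)).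
    - have -> : g (- B) = 0 by apply: g0; rewrite normrN gtr0_norm.
      by rewrite sube0.
    - by apply: continuous_in_subspaceT => s _; exact: cg'.
    - split; [|exact: cvg_at_right_filter (cg _)|exact: cvg_at_left_filter (cg _)].
      by move=> s _; exact: (@ex_derive _ _ _ _ _ _ _ (Dg s)).
    - by move=> s _; rewrite derive1E; exact: (@derive_val _ _ _ _ _ _ _ (Dg s)).
  rewrite -abse_EFin -FTC; apply: le_trans (le_abse_integral _ _ _) _ => //.
    by apply/measurable_EFinP; exact: measurable_funS mg'.
  by apply: ge0_subset_integral => //; exact: m_g'.
have -> : (\int[@lebesgue_measure R]_t `|g t|%:E =
           \int[@lebesgue_measure R]_(t in `[(- B)%R, B]) `|g t|%:E)%E.
  rewrite [RHS]integral_mkcond; apply: eq_integral => t _.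
  rewrite patchE; case: ifPn => //; rewrite notin_setE /= in_itv /= -ler_norml => /negP.
  by rewrite -ltNge => /ltW /g0 ->; rewrite normr0.
apply: (@le_trans _ _ (\int[@lebesgue_measure R]_(t in `[(- B)%R, B]) cst I t)%E).
  apply: ge0_le_integral => //.
  apply/measurable_EFinP; apply: measurableT_comp => //; exact: measurable_funS mg.
rewrite integral_cst//= lebesgue_measure_itv/= lte_fin gtrN// -EFinD.
by rewrite muleC opprK mulr_natl mulr2n.
Qed.

Section poincare.
Context {R : realType} {n : nat}.

Lemma is_derive_slice (f f' : 'rV[R]_n.+1 -> R) (v : 'rV[R]_n) t :
  is_derive (rV_cons (t, v)) (delta_mx ord0 ord0) f (f' (rV_cons (t, v))) ->
  is_derive t (1 : R) (fun s : R => f (rV_cons (s, v))) (f' (rV_cons (t, v))).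
Proof.
have E (h : R) : h *: delta_mx ord0 ord0 + rV_cons (t, v) = rV_cons (h *: (1 : R) + t, v).
  apply/rowP => i; rewrite mxE [X in X + _]mxE.
  case: (unliftP ord0 i) => [j ->|->]; first by rewrite !rV_consS mxE/= mulr0 add0r.
  by rewrite !rV_cons0 mxE eqxx.
case=> Df Df'; apply: DeriveDef.
  by move: Df; rewrite /derivable; under eq_fun do rewrite /= E.
by rewrite -Df' /derive; under [in RHS]eq_fun do rewrite /= E.
Qed.

Lemma rV_cons_continuous (v : 'rV[R]_n) : continuous (fun s : R => rV_cons (s, v)).
Proof.
move=> t; apply/cvg_ballP => e e0; near=> s.
apply/rV_ballP => // i; case: (unliftP ord0 i) => [k ->|->].
  by rewrite !rV_consS subrr normr0.
rewrite !rV_cons0 /=; near: s; exact: (nbhsx_ballx t e e0).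
Unshelve. all: by end_near. Qed.

(** Tonelli reduces this to [poincare_line] on each line parallel to the first axis. *)
Lemma poincare (f f' : 'rV[R]_n.+1 -> R) (B : R) : 0 < B ->
  continuous f -> continuous f' ->
  (forall x, is_derive x (delta_mx ord0 ord0) f (f' x)) ->
  (forall x : 'rV[R]_n.+1, B <= `|x ord0 ord0| -> f x = 0) ->
  (\int[lebesgue_rV n.+1]_x `|f x|%:E <=
   (2 * B)%:E * \int[lebesgue_rV n.+1]_x `|f' x|%:E)%E.
Proof.
move=> B0 cf cf' Df f0.
have mabs (h : 'rV[R]_n.+1 -> R) : continuous h ->
    measurable_fun setT (fun x => `|h x|%:E).
  move=> ch; apply/measurable_EFinP; apply: measurableT_comp => //.
  by apply: continuous_measurable_rV => [|x _]; [exact: openT|exact: ch].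
have E (h : 'rV[R]_n.+1 -> R) : continuous h ->
    (\int[lebesgue_rV n.+1]_x `|h x|%:E =
     \int[lebesgue_rV n]_v \int[@lebesgue_measure R]_t `|h (rV_cons (t, v))|%:E)%E.
  move=> ch; rewrite (ge0_integral_pushforward (measurable_rV_cons (n := n)))//.
  - rewrite preimage_setT fubini_tonelli2//; last by move=> p /=; rewrite lee_fin.
    by apply: measurableT_comp (mabs _ ch) _; exact: measurable_rV_cons.
  - exact: mabs.
have mE (h : 'rV[R]_n.+1 -> R) : continuous h -> measurable_fun setT
    (fun v => \int[@lebesgue_measure R]_t `|h (rV_cons (t, v))|%:E)%E.
  move=> ch.
  apply: (@measurable_fun_fubini_tonelli_G _ _ _ _ _ lebesgue_measure
    (fun p => `|h (rV_cons p)|%:E)) => //.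
  by apply: measurableT_comp (mabs _ ch) _; exact: measurable_rV_cons.
rewrite !E// -ge0_integralZl//; last 3 first.
- exact: mE.
- by move=> v _; exact: integral_ge0.
- by rewrite lee_fin mulr_ge0// ltW.
apply: ge0_le_integral => //.
- by move=> v _; exact: integral_ge0.
- exact: mE.
- by apply: measurable_funeM; exact: mE.
- move=> v _; apply: poincare_line => //.
  + by move=> t; exact: is_derive_slice.
  + move=> t; apply: (@cvg_comp _ _ _ (fun s : R => rV_cons (s, v)) f'); last exact: cf'.
    exact: rV_cons_continuous.
  + by move=> t tB; apply: f0; rewrite rV_cons0.
Qed.

End poincare.

(* One critical value at a time: compose with a translate of
   [t ^+ 3 / (2 * (1 + t ^+ 2))], which is increasing, 1-Lipschitz and has a
   critical point at 0 only. *)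
Lemma flattening {R : realType} (cs : seq R) : exists F w : R -> R,
  [/\ F 0 = 0, injective F,
      forall y, is_derive y (1 : R) F (w y) & continuous w] /\
  [/\ forall y, 0 <= w y <= 1, forall x y, `|F x - F y| <= `|x - y| &
      forall c, c \in cs -> forall y, w y <= `|y - c|].
Proof.
elim: cs => [|c cs [F [w [[F0 Finj DF cw] [w01 LF wcs]]]]].
  exists id, (fun=> 1); split; split => //.
  - by move=> y; exact: is_derive_id.
  - by move=> y; exact: cvg_cst.
  - by move=> y; rewrite ler01 lexx.
(* Without the factor 2 the derivative would exceed 1: it would reach 9/8 at [t ^+ 2 = 3]. *)
pose g (t : R) := t ^+ 3 / (2 * (1 + t ^+ 2)).
pose g' (t : R) := (t ^+ 4 + 3 * t ^+ 2) / (2 * (1 + t ^+ 2) ^+ 2).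
have d0 (t : R) : 0 < 1 + t ^+ 2 by rewrite ltr_wpDr// sqr_ge0.
(* The second factor is the difference quotient. It lies in [[0, 1]], which gives the Lipschitz
   bound, and vanishes only for [s = t = 0], which gives injectivity. *)
have gB s t : g s - g t =
    (s - t) * ((s ^+ 2 + s * t + t ^+ 2 + s ^+ 2 * t ^+ 2) / (2 * (1 + s ^+ 2) * (1 + t ^+ 2))).
  have := d0 s; have := d0 t => /gt_eqF/negbT t0 /gt_eqF/negbT s0.
  by rewrite /g; field; rewrite s0 t0.
have q0 s t : 0 <= s ^+ 2 + s * t + t ^+ 2 + s ^+ 2 * t ^+ 2 :> R by nra.
have q1 s t : s ^+ 2 + s * t + t ^+ 2 + s ^+ 2 * t ^+ 2 <= 2 * (1 + s ^+ 2) * (1 + t ^+ 2) :> R by nra.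
have den0 s t : 0 < 2 * (1 + s ^+ 2) * (1 + t ^+ 2) :> R by rewrite !mulr_gt0.
have ginj : injective g.
  move=> s t /eqP; rewrite -subr_eq0 gB mulf_eq0 subr_eq0 => /orP[/eqP //|].
  rewrite mulf_eq0 invr_eq0 (gt_eqF (den0 s t)) orbF => /eqP e.
  have := sqr_ge0 (s + t); have := sqr_ge0 (s * t).
  have := sqr_ge0 s; have := sqr_ge0 t => t2 s2 st2 st.
  have /eqP : s ^+ 2 = 0 by nra.
  have /eqP : t ^+ 2 = 0 by nra.
  by rewrite !sqrf_eq0 => /eqP -> /eqP ->.
have Lg s t : `|g s - g t| <= `|s - t|.
  rewrite gB normrM ler_piMr// ger0_norm ?divr_ge0 ?(ltW (den0 s t))//.
  by rewrite ler_pdivrMr// mul1r.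
have Dg t : is_derive t (1 : R) g (g' t).
  have Dn : is_derive t (1 : R) (fun t : R => t ^+ 3) (3 * t ^+ 2).
    rewrite (_ : (fun t => _) = horner 'X^3); last by apply/funext => u; rewrite hornerXn.
    by apply: is_derive_eq; rewrite derivXn hornerMn hornerXn mulr_natl.
  have Dd : is_derive t (1 : R) (fun t : R => 2 * (1 + t ^+ 2)) (4 * t).
    rewrite (_ : (fun t => _) = horner (2%:P * (1 + 'X^2))); last first.
      by apply/funext => u; rewrite !hornerE.
    by apply: is_derive_eq; rewrite derivM derivC derivD derivXn -polyC1 derivC !hornerE; ring.
  have nz : 2 * (1 + t ^+ 2) != 0 by rewrite gt_eqF// mulr_gt0.
  have [Dg Dg'] := is_deriveM Dn (@is_deriveV R (fun t : R => 2 * (1 + t ^+ 2)) t (4 * t) 1 nz Dd).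
  apply: DeriveDef; first exact: Dg.
  rewrite [LHS]Dg' /g' /GRing.scale /=.
  by field; rewrite gt_eqF.
have cX (n : nat) : continuous (fun t : R => t ^+ n) by exact: exprn_continuous.
have cg' : continuous g'.
  move=> t; apply: cvgM.
    by apply: cvgD; [exact: cX|apply: cvgM; [exact: cvg_cst|exact: cX]].
  apply: cvgV; first by rewrite gt_eqF// mulr_gt0// exprn_gt0.
  apply: cvgM; first exact: cvg_cst.
  apply: (@cvg_comp _ _ _ (fun t : R => 1 + t ^+ 2) (fun t : R => t ^+ 2)); last exact: cX.
  by apply: cvgD; [exact: cvg_cst|exact: cX].
have cF : continuous F.
  move=> y; apply: differentiable_continuous; apply/derivable1_diffP.
  exact: (@ex_derive _ _ _ _ _ _ _ (DF y)).
have g'0 t : 0 <= g' t.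
  have t4 : 0 <= t ^+ 4 by rewrite exprn_even_ge0.
  have t2 : 0 <= t ^+ 2 by exact: sqr_ge0.
  by rewrite divr_ge0// ?addr_ge0// mulr_ge0// exprn_ge0// ltW.
have g'1 t : g' t <= 1.
  by rewrite ler_pdivrMr ?mul1r ?mulr_gt0 ?exprn_gt0//; nra.
have g't t : g' t <= `|t|.
  rewrite ler_pdivrMr ?mulr_gt0 ?exprn_gt0// -(real_normK (num_real t)).
  have -> : t ^+ 4 = `|t| ^+ 4.
    by rewrite (_ : 4 = 2 * 2)%N// !exprM (real_normK (num_real t)).
  set a := `|t|; have a0 : 0 <= a by exact: normr_ge0.
  have := mulr_ge0 a0 (sqr_ge0 (1 - a)).
  have := mulr_ge0 (exprn_ge0 3 a0) (sqr_ge0 (1 - a)).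
  have := exprn_ge0 3 a0; have := exprn_ge0 5 a0; lra.
exists (fun y => g (F y - F c) - g (- F c)), (fun y => g' (F y - F c) * w y).
split; split.
- by rewrite F0 sub0r subrr.
- by move=> x y /addIr /ginj /addIr /Finj.
- move=> y.
  have DFc : is_derive y (1 : R) (fun y => F y - F c) (w y).
    by apply: is_derive_eq; rewrite subr0.
  have [DgF DgF'] := is_deriveB
    (@is_derive1_comp R g (fun y => F y - F c) y _ _ (Dg (F y - F c)) DFc)
    (is_derive_cst (g (- F c)) y (1 : R)).
  by apply: DeriveDef; [exact: DgF|rewrite [LHS]DgF' subr0].
- move=> y; apply: cvgM; last exact: cw.
  apply: (@cvg_comp _ _ _ (fun y => F y - F c) g'); last exact: cg'.
  by apply: cvgB; [exact: cF|exact: cvg_cst].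
- move=> y; have /andP[w0 w1] := w01 y; rewrite mulr_ge0//=.
  by rewrite -[leRHS]mul1r ler_pM.
- move=> x y; rewrite opprB addrA subrK (le_trans (Lg _ _))//.
  by rewrite opprB addrA subrK.
- move=> c'; rewrite inE => /orP[/eqP ->|c's] y; have /andP[w0 w1] := w01 y.
    apply: (@le_trans _ _ (g' (F y - F c))); first by rewrite ler_piMr.
    exact: le_trans (g't _) (LF _ _).
  by apply: le_trans (wcs _ c's y); rewrite ler_piMl.
Qed.

Section square_integrals.
Context d (T : measurableType d) (R : realType) (mu : {measure set T -> \bar R}).
Variables (E : set T) (mE : measurable E).
Implicit Types f g : T -> R.

Lemma measurable_sqr_EFin f : measurable_fun E f ->
  measurable_fun E (fun x => (f x ^+ 2)%:E).
Proof. by move=> mf; apply/measurable_EFinP; exact: measurable_funX. Qed.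

Lemma integral_sqr_lincomb (a : R) f g : measurable_fun E f -> measurable_fun E g ->
  (\int[mu]_(x in E) ((a * f x + g x) ^+ 2)%:E <=
   (2 * a ^+ 2)%:E * \int[mu]_(x in E) (f x ^+ 2)%:E +
   2%:E * \int[mu]_(x in E) (g x ^+ 2)%:E)%E.
Proof.
move=> mf mg; have mf2 := measurable_sqr_EFin _ mf.
have mg2 := measurable_sqr_EFin _ mg.
have sq0 h : forall x, E x -> (0 <= (h x ^+ 2 : R)%:E)%E.
  by move=> x _; rewrite lee_fin sqr_ge0.
have a0 : 0 <= 2 * a ^+ 2 by rewrite mulr_ge0// sqr_ge0.
rewrite -!ge0_integralZl//; try exact: sq0.
rewrite -ge0_integralD//; last 4 first.
- by move=> x _; rewrite -EFinM lee_fin mulr_ge0// sqr_ge0.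
- exact: measurable_funeM.
- by move=> x _; rewrite -EFinM lee_fin mulr_ge0// sqr_ge0.
- exact: measurable_funeM.
apply: ge0_le_integral => //.
- exact: sq0.
- apply: measurable_sqr_EFin; apply: measurable_funD => //.
  by apply: measurable_funM => //; exact: measurable_cst.
- by apply: emeasurable_funD; exact: measurable_funeM.
move=> x _; rewrite -!EFinM -EFinD lee_fin.
by have := sqr_ge0 (a * f x - g x); nra.
Qed.

(** A weighted Young inequality in place of Cauchy-Schwarz: when the integral of [f ^+ 2] is at most
    [e ^+ 2] and that of [g ^+ 2] is bounded, both terms are of order [e]. *)
Lemma integral_mul_le_sqr (e : R) f g : 0 < e ->
  measurable_fun E f -> measurable_fun E g ->
  (\int[mu]_(x in E) `|f x * g x|%:E <=
   (e^-1)%:E * \int[mu]_(x in E) (f x ^+ 2)%:E +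
   e%:E * \int[mu]_(x in E) (g x ^+ 2)%:E)%E.
Proof.
move=> e0 mf mg; have mf2 := measurable_sqr_EFin _ mf.
have mg2 := measurable_sqr_EFin _ mg.
have sq0 h : forall x, E x -> (0 <= (h x ^+ 2 : R)%:E)%E.
  by move=> x _; rewrite lee_fin sqr_ge0.
have e'0 : 0 <= e^-1 by rewrite invr_ge0 ltW.
rewrite -!ge0_integralZl//; try exact: sq0; try by rewrite lee_fin// ltW.
rewrite -ge0_integralD//; last 4 first.
- by move=> x _; rewrite -EFinM lee_fin mulr_ge0// sqr_ge0.
- exact: measurable_funeM.
- by move=> x _; rewrite -EFinM lee_fin mulr_ge0 ?sqr_ge0 ?ltW.
- exact: measurable_funeM.
apply: ge0_le_integral => //.
- apply/measurable_EFinP; apply: measurableT_comp => //; exact: measurable_funM.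
- by apply: emeasurable_funD; exact: measurable_funeM.
move=> x _; rewrite -!EFinM -EFinD lee_fin normrM.
rewrite -(real_normK (num_real (f x))) -(real_normK (num_real (g x))).
set p := `|f x|; set q := `|g x|.
have p0 : 0 <= p by exact: normr_ge0.
have q0 : 0 <= q by exact: normr_ge0.
have -> : e^-1 * p ^+ 2 + e * q ^+ 2 = e^-1 * (p - e * q) ^+ 2 + 2 * (p * q).
  by field; rewrite gt_eqF.
have := mulr_ge0 e'0 (sqr_ge0 (p - e * q)); have := mulr_ge0 p0 q0; lra.
Qed.

End square_integrals.

Lemma is_derive_lineP {R : realType} {V : normedModType R} (f : V -> R) (x v : V) (df : R) :
  is_derive x v f df <-> is_derive (0 : R) (1 : R) (fun s : R => f (s *: v + x)) df.
Proof.
have E : (fun h : R => h^-1 *: ((f \o shift x) (h *: v) - f x)) =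
    (fun h : R => h^-1 *: (((fun s : R => f (s *: v + x)) \o shift 0) (h *: (1 : R)) -
      f (0 *: v + x))).
  by apply/funext => h /=; rewrite addr0 scale0r add0r [h *: 1]mulr1.
by split=> -[D1 D2]; apply: DeriveDef;
  rewrite ?/derivable ?/derive; move: D1 D2; rewrite /derivable /derive E.
Qed.

Lemma is_derive_scalar_comp {R : realType} {V : normedModType R} (F : R -> R)
    (f : V -> R) (x v : V) (dF df : R) :
  is_derive (f x) (1 : R) F dF -> is_derive x v f df ->
  is_derive x v (fun y => F (f y)) (dF * df).
Proof.
move=> DF /is_derive_lineP Df; apply/is_derive_lineP.
apply: (@is_derive1_comp R F (fun s : R => f (s *: v + x)) 0 dF df _ Df).
by rewrite /= scale0r add0r.
Qed.

Section approximation.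
Context {R : realType} {n : nat}.
Implicit Types (Omega E K : set 'rV[R]_n.+1) (u v psi : 'rV[R]_n.+1 -> R).
Local Notation leb := (lebesgue_rV n.+1).
Local Notation e0 := (delta_mx ord0 ord0 : 'rV[R]_n.+1).

(** What is kept of a test function when only its first partial derivative matters. Vanishing
    outside [Omega] lets integrals over [Omega] be extended to the whole space, where the Poincare
    inequality is stated. *)
Definition test_pair Omega psi (dpsi : 'rV[R]_n.+1 -> R) : Prop :=
  [/\ continuous psi, continuous dpsi, forall x, is_derive x e0 psi (dpsi x) &
      forall x, ~ Omega x -> psi x = 0 /\ dpsi x = 0].

(* The part of membership in H^1_0 that is needed: only one partial derivative
   is considered, and it is merely bounded in L^2. *)
Definition approximable Omega E u : Prop :=
  exists2 M : R, 0 <= M & forall eps : R, 0 < eps -> exists psi dpsi,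
    [/\ test_pair Omega psi dpsi,
        (\int[leb]_(x in E) ((psi x - u x) ^+ 2)%:E <= eps%:E)%E &
        (\int[leb]_(x in E) (dpsi x ^+ 2)%:E <= M%:E)%E].

Lemma continuous_measurable_rVS E psi : measurable E -> continuous psi ->
  measurable_fun E psi.
Proof.
move=> mE cpsi; apply: (measurable_funS measurableT (subsetT E)).
by apply: continuous_measurable_rV => [|x _]; [exact: openT|exact: cpsi].
Qed.

Lemma approximable_lincomb Omega E (a : R) u v : measurable E ->
  measurable_fun E u -> measurable_fun E v ->
  approximable Omega E u -> approximable Omega E v ->
  approximable Omega E (fun x => a * u x + v x).
Proof.
move=> mE mu mv [Mu Mu0 hu] [Mv Mv0 hv].
have a2 : 0 <= a ^+ 2 by exact: sqr_ge0.
exists (2 * a ^+ 2 * Mu + 2 * Mv); first by have := mulr_ge0 a2 Mu0; lra.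
(* [integral_sqr_lincomb] turns two errors [e] into [2 * a ^+ 2 * e + 2 * e], which is [eps]. *)
move=> eps eps0; pose e := eps / (2 * a ^+ 2 + 2).
have d0 : 0 < 2 * a ^+ 2 + 2 by lra.
have ep : 0 < e by rewrite divr_gt0.
have [p [dp [[cp cdp Dp p0] pu pM]]] := hu e ep.
have [q [dq [[cq cdq Dq q0] qv qM]]] := hv e ep.
exists (fun x => a * p x + q x), (fun x => a * dp x + dq x); split.
- split.
  + by move=> x; exact: (cvgD (cvgM (cvg_cst a) (cp x)) (cq x)).
  + by move=> x; exact: (cvgD (cvgM (cvg_cst a) (cdp x)) (cdq x)).
  + move=> x; have [D1 D2] := is_deriveD (is_deriveZ a (Dp x)) (Dq x).
    by apply: DeriveDef; [exact: D1|rewrite [LHS]D2].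
  + move=> x Ox; have [-> ->] := p0 x Ox; have [-> ->] := q0 x Ox.
    by rewrite mulr0 addr0.
- rewrite (_ : (fun x => _) = fun x => ((a * (p x - u x) + (q x - v x)) ^+ 2)%:E); last first.
    by apply/funext => x; congr (_ ^+ 2)%:E; ring.
  apply: le_trans (integral_sqr_lincomb _ _ _ leb E mE a (fun x => p x - u x) (fun x => q x - v x) _ _) _.
  + by apply: measurable_funB => //; exact: continuous_measurable_rVS.
  + by apply: measurable_funB => //; exact: continuous_measurable_rVS.
  have -> : eps%:E = ((2 * a ^+ 2)%:E * e%:E + 2%:E * e%:E)%E.
    by rewrite -!EFinM -EFinD -mulrDl mulrC /e divfK// gt_eqF.
  by apply: leeD; apply: lee_wpmul2l => //; rewrite lee_fin// mulr_ge0.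
- apply: le_trans (integral_sqr_lincomb _ _ _ leb E mE a dp dq _ _) _.
  + exact: continuous_measurable_rVS.
  + exact: continuous_measurable_rVS.
  have -> : (2 * a ^+ 2 * Mu + 2 * Mv)%:E = ((2 * a ^+ 2)%:E * Mu%:E + 2%:E * Mv%:E)%E.
    by rewrite -!EFinM -EFinD.
  by apply: leeD; apply: lee_wpmul2l => //; rewrite lee_fin// mulr_ge0.
Qed.

Lemma approximable_sum Omega E (I : Type) (r : seq I) (c : I -> R) (u : I -> _) :
  measurable E -> (forall i, measurable_fun E (u i)) ->
  (forall i, approximable Omega E (u i)) ->
  approximable Omega E (fun x => \sum_(i <- r) c i * u i x).
Proof.
move=> mE mu au; elim: r => [|i r IHr].
  exists 0 => // eps eps0; exists (fun=> 0), (fun=> 0); split.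
  - by split => // x; [exact: cst_continuous|exact: cst_continuous|exact: is_derive_cst].
  - by rewrite integral0_eq ?lee_fin ?ltW// => x _; rewrite big_nil subr0 expr0n.
  - by rewrite integral0_eq// => x _; rewrite expr0n.
under eq_fun do rewrite big_cons.
apply: approximable_lincomb => //.
by apply: measurable_sum => j; apply: measurable_funM => //; exact: measurable_cst.
Qed.

(* With [F' <= dist (_, cs)], the gradient of [F \o psi] is at most
   [|psi - u| |dpsi|], which tends to 0 in L^1 as [psi] tends to [u]; by the
   Poincare inequality [F \o psi] tends to 0, while it tends to [F \o u]. *)
Lemma approximable_finite_range Omega E u (B : R) (cs : seq R) (c : R) K :
  0 < B -> (forall x : 'rV[R]_n.+1, Omega x -> `|x ord0 ord0| < B) ->
  measurable E -> E `<=` Omega -> leb.-negligible (Omega `\` E) ->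
  (leb E < +oo)%E -> measurable_fun E u -> approximable Omega E u ->
  (forall x, E x -> u x \in cs) ->
  measurable K -> K `<=` E -> (forall x, K x -> u x = c) -> (0 < leb K)%E ->
  c = 0.
Proof.
move=> B0 OB mE EO [N [mN N0 EN]] Efin mu [M M0 hu] ucs mK KE uK K0.
have [F [w [[F0 Finj DF cw] [w01 LF wcs]]]] := flattening cs.
have Kfin : (leb K < +oo)%E by apply: le_lt_trans Efin; apply: le_measure; rewrite ?inE.
pose m := fine (leb E); pose k := fine (leb K).
have mEE : leb E = m%:E by rewrite fineK// ge0_fin_numE.
have mKE : leb K = k%:E by rewrite fineK// ge0_fin_numE.
have k0 : 0 < k by rewrite -lte_fin -mKE.
have m0 : 0 <= m by rewrite -lee_fin -mEE.
(* Up to the factor [e], the first summand bounds the integral of [|F (psi x)|] by way of the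
   Poincare inequality, the second that of [|psi x - u x|]. *)
pose C := 2 * B * (1 + M) + (1 + m).
have C0 : 0 < C by have := mulr_ge0 (ltW B0) M0; rewrite /C; lra.
have key e : 0 < e -> `|F c| * k <= e * C.
  move=> ep.
  have [psi [dpsi [[cp cdp Dp p0] pu pM]]] := hu (e ^+ 2) (exprn_gt0 2 ep).
  have cF : continuous F.
    move=> y; apply: differentiable_continuous; apply/derivable1_diffP.
    exact: (@ex_derive _ _ _ _ _ _ _ (DF y)).
  pose f x := F (psi x); pose df x := w (psi x) * dpsi x.
  have cf : continuous f.
    by move=> x; apply: (@cvg_comp _ _ _ psi F); [exact: cp|exact: cF].
  have cdf : continuous df.
    have cwp : continuous (fun x => w (psi x)).
      by move=> x; apply: (@cvg_comp _ _ _ psi w); [exact: cp|exact: cw].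
    by move=> x; exact: (cvgM (cwp x) (cdp x)).
  have Df x : is_derive x e0 f (df x) by exact: is_derive_scalar_comp.
  have fB (x : 'rV[R]_n.+1) : B <= `|x ord0 ord0| -> f x = 0.
    move=> Bx; have nOx : ~ Omega x by move=> /OB; rewrite ltNge Bx.
    by have [psi0 _] := p0 x nOx; rewrite /f psi0.
  have mpsi : measurable_fun E psi by exact: continuous_measurable_rVS.
  have mdpsi : measurable_fun E dpsi by exact: continuous_measurable_rVS.
  have mpu : measurable_fun E (fun x => psi x - u x) by exact: measurable_funB.
  have pu0 : (\int[leb]_(x in E) ((psi x - u x) ^+ 2)%:E * (e^-1)%:E <= e%:E)%E.
    apply: (@le_trans _ _ ((e ^+ 2)%:E * (e^-1)%:E)%E).
      by apply: lee_wpmul2r => //; rewrite lee_fin invr_ge0 ltW.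
    by rewrite -EFinM lee_fin expr2 mulfK ?gt_eqF.
  have df_le : (\int[leb]_x `|df x|%:E <= (e * (1 + M))%:E)%E.
    have -> : (\int[leb]_x `|df x|%:E = \int[leb]_(x in E) `|df x|%:E)%E.
      apply: (eq_integral_off_null _ N) => // x Nx.
      rewrite patch_setT patchE; case: ifPn => // /negP Ex.
      have [|_ dp0] := p0 x; last by rewrite /df dp0 mulr0 normr0.
      by move=> Ox; apply: Nx; apply: EN; split => // /mem_set.
    apply: (@le_trans _ _ (\int[leb]_(x in E) `|(psi x - u x) * dpsi x|%:E)%E).
      apply: ge0_le_integral => //.
      - apply/measurable_EFinP; apply: measurableT_comp => //.
        exact: continuous_measurable_rVS.
      - by apply/measurable_EFinP; apply: measurableT_comp => //; exact: measurable_funM.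
      move=> x Ex; rewrite lee_fin !normrM ler_wpM2r//.
      have /andP[w0 _] := w01 (psi x).
      by rewrite ger0_norm// wcs// ucs.
    apply: le_trans (integral_mul_le_sqr _ _ _ _ _ mE _ _ _ ep mpu mdpsi) _.
    rewrite mulrDr mulr1 EFinD; apply: leeD; first by rewrite muleC.
    by rewrite EFinM; apply: lee_wpmul2l => //; rewrite lee_fin ltW.
  have f_le : (\int[leb]_x `|f x|%:E <= (2 * B * (e * (1 + M)))%:E)%E.
    apply: le_trans (poincare f df B B0 cf cdf Df fB) _.
    by rewrite [leRHS]EFinM; apply: lee_wpmul2l => //; rewrite lee_fin mulr_ge0// ltW.
  have pu_le : (\int[leb]_(x in E) `|psi x - u x|%:E <= (e * (1 + m))%:E)%E.
    (* The L^1 distance is controlled by the L^2 distance by taking 1 as the second factor, since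
       [E] has finite measure. *)
    have := integral_mul_le_sqr _ _ _ leb _ mE e (fun x => psi x - u x) (fun=> 1) ep mpu (measurable_cst _).
    under eq_integral do rewrite mulr1.
    under [X in (_ <= _ + _ * X)%E -> _]eq_integral do rewrite expr1n.
    have -> : (\int[leb]_(x in E) 1 = m%:E)%E by rewrite integral_cst// mul1e; exact: mEE.
    move=> /le_trans; apply; rewrite -EFinM.
    by rewrite mulrDr mulr1 EFinD; apply: leeD => //; rewrite muleC.
  rewrite -lee_fin EFinM -mKE -integral_cst//.
  have mabs D (h : 'rV[R]_n.+1 -> R) : measurable D -> continuous h -> measurable_fun D (fun x => `|h x|%:E).
    move=> mD ch; apply/measurable_EFinP; apply: measurableT_comp => //.
    exact: continuous_measurable_rVS.
  have mpuK : measurable_fun K (fun x => `|psi x - u x|%:E).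
    apply/measurable_EFinP; apply: measurableT_comp => //.
    exact: measurable_funS mpu.
  (* On [K], where [u] equals [c], the Lipschitz bound gives
     [|F c| <= |F (psi x)| + |psi x - u x|]. *)
  apply: (@le_trans _ _ (\int[leb]_(x in K) (`|f x|%:E + `|psi x - u x|%:E))%E).
    apply: ge0_le_integral => //.
    - by move=> x _; rewrite lee_fin.
    - by apply: emeasurable_funD => //; exact: mabs.
    move=> x Kx; rewrite /= -EFinD lee_fin uK//.
    have := LF c (psi x); rewrite (distrC c) => LFx.
    have := ler_distD 0 (F c) (F (psi x)).
    have := ler_normD (F c - F (psi x)) (F (psi x)); rewrite subrK => h _.
    by rewrite (le_trans h)// addrC lerD2l.
  rewrite ge0_integralD//; last exact: mabs.
  have -> : e * C = 2 * B * (e * (1 + M)) + e * (1 + m) by rewrite /C; ring.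
  rewrite EFinD; apply: leeD.
    by apply: le_trans f_le; apply: ge0_subset_integral => //; exact: mabs.
  apply: le_trans pu_le; apply: ge0_subset_integral => //.
  by apply/measurable_EFinP; exact: measurableT_comp.
apply: Finj; rewrite F0; apply/eqP; rewrite -normr_eq0 eq_le normr_ge0 andbT leNgt.
apply/negP => Fc.
have p : 0 < `|F c| * k by rewrite mulr_gt0.
have := key (`|F c| * k / (2 * C)); rewrite divr_gt0 ?mulr_gt0// => /(_ isT).
by rewrite invfM mulrA -(mulrA _ _ C) mulVf ?gt_eqF// mulr1 ler_pdivlMr// => h; lra.
Qed.

End approximation.

Lemma continuous_compact_bounded {R : realType} {n : nat} (K : set 'rV[R]_n)
    (f : 'rV[R]_n -> R) : compact K -> continuous f ->
  exists2 C : R, 0 <= C & forall x, K x -> `|f x| <= C.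
Proof.
move=> cK cf; have [->|/set0P K0] := eqVneq K set0; first by exists 0.
have [|c _ cmax] := @compact_EVT_max _ _ (fun x => `|f x|) K K0 cK.
  apply: continuous_in_subspaceT => x _; apply: (@cvg_comp _ _ _ f (@Num.norm _ R)).
    exact: cf.
  exact: norm_continuous.
by exists `|f c| => // x Kx; apply: cmax; rewrite inE.
Qed.

Lemma cvg0_ereal_le {R : realType} (u : nat -> \bar R) (e : R) : 0 < e ->
  u @ \oo --> 0%E -> \forall m \near \oo, (u m <= e%:E)%E.
Proof.
move=> ep u0; have : nbhs (0%E : \bar R) [set x | (x < e%:E)%E].
  by apply: open_nbhs_nbhs; split; [exact: open_ereal_lt_ereal|rewrite /= lte_fin].
by move=> /u0[m0 _ h]; exists m0 => // m /h /ltW.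
Qed.

Section approximation_in_H10.
Context {R : realType} {n : nat}.
Implicit Types (Omega E K : set 'rV[R]_n.+1).
Local Notation leb := (lebesgue_rV n.+1).

Lemma derive_eq0_near (f : 'rV[R]_n.+1 -> R) (x v : 'rV[R]_n.+1) :
  (\forall y \near x, f y = 0) -> 'D_v f x = 0.
Proof.
move=> f0; rewrite (@near_eq_derive _ _ _ f (cst 0) x v f0).
exact: derive_val.
Qed.

Lemma notin_supp_near0 D (f : 'rV[R]_n.+1 -> R) x :
  nbhs x D -> ~ supp D f x -> \forall y \near x, f y = 0.
Proof.
move=> Dx fx; have : nbhs x (~` supp D f).
  by apply: open_nbhs_nbhs; split => //; apply: closed_openC; exact: closed_closure.
move: Dx; apply: filterS2 => y Dy sy; apply: contrapT => /eqP fy.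
by apply: sy; exact: subset_closure.
Qed.

Lemma test_function_pair Omega (f : 'rV[R]_n.+1 -> R) : test_function Omega f ->
  test_pair Omega f (partial ord0 f).
Proof.
move=> [sm _ fO]; have [df cdf] := sm 1%N; split.
- by move=> x; exact: differentiable_continuous.
- exact: cdf.
- by move=> x; apply: DeriveDef => //; exact: diff_derivable.
- move=> x Ox; have f0 : \forall y \near x, f y = 0.
    by apply: (@notin_supp_near0 setT) => [|/fO//]; exact: filterT.
  by split; [exact: nbhs_singleton f0|exact: derive_eq0_near].
Qed.

Lemma H10_approximable Omega E (u : 'rV[R]_n.+1 -> R) : open Omega -> bounded_set Omega ->
  measurable E -> E `<=` Omega -> leb.-negligible (Omega `\` E) ->
  H10 Omega u -> approximable Omega E u.
Proof.
move=> oO bO mE EO EN [_ [g [psi [mg tpsi cpsi cdpsi]]]].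
have mO : measurable Omega by exact: open_measurable_rV.
have Ofin : (leb Omega < +oo)%E by exact: lebesgue_rV_bounded.
pose D m := partial ord0 (psi m).
have mD m : measurable_fun Omega (D m).
  by apply: continuous_measurable_rVS => //; have [] := test_function_pair _ _ (tpsi m).
have near1 := cvg0_ereal_le _ 1 ltr01 (cdpsi ord0).
have [m0 hm0] : exists m0, (\int[leb]_(x in Omega) ((D m0 x - g ord0 x) ^+ 2)%:E <= 1%:E)%E.
  by have [m _ hm] := near1; exists m; apply: hm => /=.
(* The weak derivative [g] is given only as a limit, with no bound on its own L^2 norm. Such a bound
   comes from comparing it with a single [D m0], which is continuous with compact support and hence
   bounded. *)
have [C C0 hC] : exists2 C : R, 0 <= C & (\int[leb]_(x in Omega) (D m0 x ^+ 2)%:E <= C%:E)%E.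
  have [_ cK sK] := tpsi m0; have [_ cD _ _] := test_function_pair _ _ (tpsi m0).
  have [c c0 hc] := continuous_compact_bounded _ _ cK cD.
  have cO x : Omega x -> ((D m0 x ^+ 2)%:E <= (c ^+ 2)%:E)%E.
    move=> _; rewrite lee_fin -(real_normK (num_real (D m0 x))) ler_sqr ?nnegrE//.
    have [/hc //|sx] := pselect (supp setT (psi m0) x).
    rewrite /D /partial derive_eq0_near ?normr0//.
    by apply: notin_supp_near0 sx; exact: filterT.
  exists (c ^+ 2 * fine (leb Omega)).
    by rewrite mulr_ge0 ?sqr_ge0// fine_ge0.
  rewrite EFinM fineK ?ge0_fin_numE// -integral_cst//.
  apply: ge0_le_integral => //.
  - by move=> x _; rewrite lee_fin sqr_ge0.
  - exact: measurable_sqr_EFin.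
(* Passing from [D m0] to [g ord0] and then to [D m] gives [2 * 1 + 2 * (2 * 1 + 2 * C)], which is
   below this bound. *)
exists (4 + 2 * (4 + 2 * C)); first by lra.
move=> eps eps0; have near2 := cvg0_ereal_le _ eps eps0 cpsi.
have [m [hm1 hm2]] : exists m,
    (\int[leb]_(x in Omega) ((psi m x - u x) ^+ 2)%:E <= eps%:E)%E /\
    (\int[leb]_(x in Omega) ((D m x - g ord0 x) ^+ 2)%:E <= 1%:E)%E.
  have [m1 _ h1] := near1; have [m2 _ h2] := near2; exists (maxn m1 m2).
  by split; [apply: h2; rewrite /= leq_maxr|apply: h1; rewrite /= leq_maxl].
exists (psi m), (D m); split; first exact: test_function_pair.
  by rewrite -(integral_off_negligible _ Omega).
rewrite -(integral_off_negligible _ Omega)//.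
have mDg i : measurable_fun Omega (fun x => D i x - g ord0 x) by exact: measurable_funB.
have h1 : (\int[leb]_(x in Omega) (D m x ^+ 2)%:E <=
    2%:E * \int[leb]_(x in Omega) ((D m x - g ord0 x) ^+ 2)%:E +
    2%:E * \int[leb]_(x in Omega) (g ord0 x ^+ 2)%:E)%E.
  have := integral_sqr_lincomb _ _ _ leb Omega mO 1 (fun x => D m x - g ord0 x)
    (fun x => g ord0 x) (mDg m) (mg ord0).
  rewrite expr1n mulr1; congr (_ <= _)%E.
  by apply: eq_integral => x _; congr (_ ^+ 2)%:E; ring.
have h2 : (\int[leb]_(x in Omega) (g ord0 x ^+ 2)%:E <=
    2%:E * \int[leb]_(x in Omega) ((D m0 x - g ord0 x) ^+ 2)%:E +
    2%:E * \int[leb]_(x in Omega) (D m0 x ^+ 2)%:E)%E.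
  have := integral_sqr_lincomb _ _ _ leb Omega mO (-1) (fun x => D m0 x - g ord0 x)
    (fun x => D m0 x) (mDg m0) (mD m0).
  rewrite sqrrN expr1n mulr1; congr (_ <= _)%E.
  by apply: eq_integral => x _; congr (_ ^+ 2)%:E; ring.
apply: (le_trans h1).
apply: (@le_trans _ _ (2%:E * 1%:E + 2%:E * (2%:E * 1%:E + 2%:E * C%:E))%E).
  apply: leeD; apply: lee_wpmul2l => //; apply: (le_trans h2).
  by apply: leeD; apply: lee_wpmul2l.
by rewrite -!(EFinM, EFinD) lee_fin; lra.
Qed.

End approximation_in_H10.

(** * Stiffness matrices *)

Section bounded_measurable_functions.
Context {d} {T : measurableType d} {R : realType} (mu : {measure set T -> \bar R}).
Variables (E : set T) (mE : measurable E) (Efin : (mu E < +oo)%E).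
Implicit Types f g : T -> R.

(** Products of integrable functions may fail to be integrable, whereas this class is closed under
    sums and products and, [E] having finite measure, consists of integrable functions. *)
Definition bounded_measurable f : Prop :=
  measurable_fun E f /\ exists C : R, forall x, E x -> `|f x| <= C.

Lemma bounded_measurable_cst (c : R) : bounded_measurable (fun=> c).
Proof. by split; [exact: measurable_cst|exists `|c|]. Qed.

Lemma bounded_measurableD f g : bounded_measurable f -> bounded_measurable g ->
  bounded_measurable (fun x => f x + g x).
Proof.
move=> [mf [C fC]] [mg [D gD]]; split; first exact: measurable_funD.
exists (C + D) => x Ex; apply: le_trans (ler_normD _ _) _.
by rewrite lerD ?fC ?gD.
Qed.

Lemma bounded_measurableM f g : bounded_measurable f -> bounded_measurable g ->
  bounded_measurable (fun x => f x * g x).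
Proof.
move=> [mf [C fC]] [mg [D gD]]; split; first exact: measurable_funM.
by exists (C * D) => x Ex; rewrite normrM ler_pM ?fC ?gD.
Qed.

Lemma bounded_measurable_sum (I : Type) (r : seq I) (f : I -> T -> R) :
  (forall i, bounded_measurable (f i)) ->
  bounded_measurable (fun x => \sum_(i <- r) f i x).
Proof.
move=> fP; elim: r => [|i r IHr].
  by under eq_fun do rewrite big_nil; exact: bounded_measurable_cst.
by under eq_fun do rewrite big_cons; exact: bounded_measurableD.
Qed.

Lemma bounded_measurable_integrable f : bounded_measurable f ->
  mu.-integrable E (EFin \o f).
Proof.
move=> [mf [C fC]]; apply: measurable_bounded_integrable => //.
exists C; split; first exact: num_real.
by move=> M CM x Ex; exact: le_trans (fC x Ex) (ltW CM).
Qed.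

Lemma Rintegral_lincomb (a : R) f g : bounded_measurable f -> bounded_measurable g ->
  \int[mu]_(x in E) (a * f x + g x) = a * \int[mu]_(x in E) f x + \int[mu]_(x in E) g x.
Proof.
move=> bf bg; rewrite RintegralD//; last 2 first.
- apply: bounded_measurable_integrable.
  exact: bounded_measurableM (bounded_measurable_cst a) bf.
- exact: bounded_measurable_integrable.
by rewrite RintegralZl//; exact: bounded_measurable_integrable.
Qed.

Lemma Rintegral_sum (I : Type) (r : seq I) (c : I -> R) (f : I -> T -> R) :
  (forall i, bounded_measurable (f i)) ->
  \int[mu]_(x in E) (\sum_(i <- r) c i * f i x) =
  \sum_(i <- r) c i * \int[mu]_(x in E) f i x.
Proof.
move=> fP; elim: r => [|i r IHr].
  rewrite big_nil; under eq_Rintegral do rewrite big_nil.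
  by rewrite Rintegral_cst// mul0r.
under eq_Rintegral do rewrite big_cons.
rewrite Rintegral_lincomb ?IHr ?big_cons//.
by apply: bounded_measurable_sum => j; apply: bounded_measurableM => //; exact: bounded_measurable_cst.
Qed.

End bounded_measurable_functions.

Section stiffness_forms.
Context {R : realType} {d N : nat}.
Local Notation leb := (lebesgue_rV d).
Variables (Omega E : set 'rV[R]_d) (phi : 'I_N -> 'rV[R]_d -> R).
Hypotheses (mE : measurable E) (Efin : (leb E < +oo)%E) (EO : E `<=` Omega).
Hypothesis (EN : leb.-negligible (Omega `\` E)).
Hypothesis (bphi : forall j l, bounded_measurable E (partial l (phi j))).
Implicit Types (k : 'rV[R]_d -> R) (x y : 'rV[R]_N).

Lemma stiffness_tr k : (stiffness Omega k phi)^T = stiffness Omega k phi.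
Proof.
apply/matrixP => i j; rewrite !mxE; apply: eq_Rintegral => t _.
by apply: eq_bigr => l _; ring.
Qed.

Definition grad x (l : 'I_d) t : R := \sum_j x ord0 j * partial l (phi j) t.

Lemma bounded_measurable_grad x l : bounded_measurable E (grad x l).
Proof.
apply: bounded_measurable_sum => j; apply: bounded_measurableM => //.
exact: bounded_measurable_cst.
Qed.

Definition energy k x y t : R := \sum_l grad x l t * (k t * grad y l t).

Lemma bounded_measurable_energy k x y : bounded_measurable E k ->
  bounded_measurable E (energy k x y).
Proof.
move=> bk; apply: bounded_measurable_sum => l.
apply: bounded_measurableM; first exact: bounded_measurable_grad.
by apply: bounded_measurableM => //; exact: bounded_measurable_grad.
Qed.

Lemma bform_stiffness k x y : bounded_measurable E k ->
  bform R N (stiffness Omega k phi) x y = \int[leb]_(t in E) energy k x y t.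
Proof.
move=> bk.
pose F i j t := \sum_l partial l (phi i) t * (k t * partial l (phi j) t).
have bF i j : bounded_measurable E (F i j).
  apply: bounded_measurable_sum => l; apply: bounded_measurableM => //.
  exact: bounded_measurableM.
have FE i j : stiffness Omega k phi i j = \int[leb]_(t in E) F i j t.
  by rewrite mxE /Rintegral (integral_off_negligible _ Omega E).
rewrite bformE.
under eq_bigr => i _ do under eq_bigr => j _ do rewrite FE.
transitivity (\int[leb]_(t in E) \sum_i x ord0 i * \sum_j y ord0 j * F i j t).
  rewrite Rintegral_sum//; last first.
    move=> i; apply: bounded_measurable_sum => j; apply: bounded_measurableM => //.
    exact: bounded_measurable_cst.
  apply: eq_bigr => i _; rewrite Rintegral_sum// mulr_sumr.
  by apply: eq_bigr => j _; rewrite mulrAC mulrA.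
apply: eq_Rintegral => t _; rewrite /energy /grad /F.
under eq_bigr => i _.
  rewrite mulr_sumr; under eq_bigr => j _ do rewrite !mulr_sumr.
  rewrite exchange_big; over.
rewrite exchange_big; apply: eq_bigr => l _ /=.
rewrite mulr_suml; apply: eq_bigr => i _; rewrite !mulr_sumr.
by apply: eq_bigr => j _; ring.
Qed.

(** For each coordinate, the square of [(k t - m) * grad w l t - grad z l t] is nonnegative, and
    [(k t - m) ^+ 2 <= r ^+ 2]. The first alternative serves the points where [k] may leave [[c, d]]
    because [w] has no gradient there. *)
Lemma energy_le (m r : R) k w z t :
  (grad w ^~ t = (fun=> 0)) \/ `|k t - m| <= r ->
  2 * (energy k w z t - m * energy (fun=> 1) w z t) <=
  r ^+ 2 * energy (fun=> 1) w w t + energy (fun=> 1) z z t.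
Proof.
move=> h; rewrite /energy !mulr_sumr -sumrB mulr_sumr -big_split /=.
apply: ler_sum => l _; case: h => [/(congr1 (@^~ l)) -> |kr].
  by have := sqr_ge0 (grad z l t); lra.
have kr2 : (k t - m) ^+ 2 <= r ^+ 2.
  rewrite -(real_normK (num_real (k t - m))) ler_sqr ?nnegrE//.
  exact: le_trans kr.
have := sqr_ge0 ((k t - m) * grad w l t - grad z l t).
have := mulr_ge0 (_ : 0 <= r ^+ 2 - (k t - m) ^+ 2) (sqr_ge0 (grad w l t)).
by rewrite subr_ge0 => /(_ kr2); nra.
Qed.

Lemma bform_stiffness_le (m r : R) k w z : bounded_measurable E k ->
  (forall t, E t -> (grad w ^~ t = (fun=> 0)) \/ `|k t - m| <= r) ->
  2 * bform R N (stiffness Omega k phi - m *: stiffness Omega (fun=> 1) phi) w z <=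
  r ^+ 2 * bform R N (stiffness Omega (fun=> 1) phi) w w +
  bform R N (stiffness Omega (fun=> 1) phi) z z.
Proof.
move=> bk h; have b1 := bounded_measurable_cst E (1 : R).
rewrite bformBm !bform_stiffness//.
have be := bounded_measurable_energy.
have -> : 2 * (\int[leb]_(t in E) energy k w z t -
      m * \int[leb]_(t in E) energy (fun=> 1) w z t) =
    \int[leb]_(t in E) (2 * energy k w z t + (- (2 * m)) * energy (fun=> 1) w z t).
  rewrite Rintegral_lincomb//; [|exact: be|].
    rewrite RintegralZl//; first by ring.
    by apply: bounded_measurable_integrable => //; exact: be.
  by apply: bounded_measurableM; [exact: bounded_measurable_cst|exact: be].
rewrite -Rintegral_lincomb//; [|exact: be|exact: be].
apply: le_Rintegral => //.
- apply: bounded_measurable_integrable => //; apply: bounded_measurableD;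
    by apply: bounded_measurableM; [exact: bounded_measurable_cst|exact: be].
- apply: bounded_measurable_integrable => //; apply: bounded_measurableD; last exact: be.
  by apply: bounded_measurableM; [exact: bounded_measurable_cst|exact: be].
by move=> t Et; have := energy_le m r k w z t (h t Et); lra.
Qed.

Lemma bform_stiffness_ge (alpha : R) k x : bounded_measurable E k ->
  (forall t, E t -> alpha <= k t) ->
  alpha * bform R N (stiffness Omega (fun=> 1) phi) x x <=
  bform R N (stiffness Omega k phi) x x.
Proof.
move=> bk ka; have b1 := bounded_measurable_cst E (1 : R).
have be := bounded_measurable_energy.
rewrite !bform_stiffness// -RintegralZl//; last first.
  by apply: bounded_measurable_integrable => //; exact: be.
apply: le_Rintegral => //.
- apply: bounded_measurable_integrable => //.
  by apply: bounded_measurableM; [exact: bounded_measurable_cst|exact: be].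
- by apply: bounded_measurable_integrable => //; exact: be.
move=> t Et; rewrite mulr_sumr; apply: ler_sum => l _.
by have := ka t Et; have := sqr_ge0 (grad x l t); nra.
Qed.

Lemma bform_stiffness_gt0 x :
  ~ leb.-negligible (E `&` [set t | exists l, grad x l t != 0]) ->
  0 < bform R N (stiffness Omega (fun=> 1) phi) x x.
Proof.
move=> h; have b1 := bounded_measurable_cst E (1 : R).
have be := bounded_measurable_energy _ x x b1.
have e0 t : 0 <= energy (fun=> 1) x x t.
  by apply: sumr_ge0 => l _; rewrite mul1r -expr2 sqr_ge0.
rewrite bform_stiffness// lt_def Rintegral_ge0// andbT.
apply/eqP => I0; apply: h.
have : (\int[leb]_(t in E) `|(energy (fun=> 1) x x t)%:E| = 0)%E.
  under eq_integral do rewrite gee0_abs ?lee_fin//.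
  move: I0; rewrite /Rintegral => I0; rewrite -[LHS]fineK ?I0//.
  by apply: integrable_fin_num => //; exact: bounded_measurable_integrable.
have me : measurable_fun E (fun t => (energy (fun=> 1) x x t)%:E).
  by apply/measurable_EFinP; case: be.
move=> /(ae_eq_integral_abs _ mE me)[A [mA A0 EA]]; exists A; split => // t [Et [l tl]]; apply: EA => /= /(_ Et) [].
apply/eqP; rewrite gt_eqF// /energy (bigD1 l)//= mul1r -expr2 ltr_pwDl//.
  by rewrite lt_def sqrf_eq0 tl sqr_ge0.
by apply: sumr_ge0 => i _; rewrite mul1r -expr2 sqr_ge0.
Qed.

End stiffness_forms.

Lemma measurable_not_negligible {d} {T : measurableType d} {R : realType}
    (mu : {measure set T -> \bar R}) (A : set T) :
  measurable A -> (0 < mu A)%E -> ~ mu.-negligible A.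
Proof. by move=> mA + nA; rewrite (measure_negligible mA nA) ltxx. Qed.

(** * Finite element functions on a mesh *)

Section finite_element_functions.
Context {R : realType} {n : nat}.
Implicit Types (Omega E K U : set 'rV[R]_n) (cells : set (set 'rV[R]_n)).
Local Notation leb := (lebesgue_rV n).

(* [E] is where [k] agrees with a Borel function and the basis functions are
   locally polynomial; integrals over [Omega] are computed on [E]. *)
Lemma exists_good_set Omega cells (k : 'rV[R]_n -> R) : open Omega -> mesh Omega cells ->
  Lebesgue_measurable (closure Omega) k ->
  exists E, [/\ measurable E, E `<=` Omega, leb.-negligible (Omega `\` E),
    forall x, E x -> exists2 K, cells K & K° x & measurable_fun E k].
Proof.
move=> oO [fcells cellP _ cover] [g mg [N [mN N0 kg]]].
pose G := Omega `&` \bigcup_(K in cells) K°.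
have oG : open G.
  by apply: openI => //; apply: bigcup_open => K _; exact: open_interior.
have mG := open_measurable_rV n G oG.
exists (G `\` N); split.
- exact: measurableD.
- by move=> x [[]].
- have /finite_seqP[s sE] := fcells.
  have nN : leb.-negligible N by exists N; split.
  have nK K : K \in s -> leb.-negligible (K `\` K°).
    move=> Ks; have Kc : cells K by rewrite sE.
    by have [[]] := cellP K Kc.
  apply: negligibleS (negligibleU nN (negligible_bigcup_seq _ _ _ _ nK)) => x [Ox GNx].
  have [Nx|Nx] := pselect (N x); [by left|right].
  have : closure Omega x by exact: subset_closure.
  rewrite -cover sE => -[K Ks Kx]; exists K => //; split => // Kx'.
  by apply: GNx; split => //; split => //; exists K => //; rewrite sE.
- by move=> x [[_ [K cK Kx]] _]; exists K.
have mC : measurable (closure Omega).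
  rewrite -[closure _]setCK; apply: measurableC; apply: open_measurable_rV.
  by apply: closed_openC; exact: closed_closure.
have GC : G `\` N `<=` closure Omega by move=> x [[Ox _] _]; exact: subset_closure.
apply: eq_measurable_fun (measurable_funS mC GC mg) => x /set_mem[[Ox _] Nx].
apply/esym; apply: contrapT => kx; apply: Nx; apply: kg => /= h; apply: kx; apply: h.
exact: subset_closure.
Qed.

Lemma piecewise_poly_fun cells (u : 'rV[R]_n -> R) K : piecewise_polynomial cells u ->
  cells K -> exists f df, poly_fun f df /\ forall x, K x -> u x = f x.
Proof.
move=> pu /pu[p up]; have [df fP] := poly_fun_meval p.
by exists (fun x => mpoly.meval (fun l => x ord0 l) p), df.
Qed.

Lemma poly_fun_interior K (u f : 'rV[R]_n -> R) df x : poly_fun f df ->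
  (forall y, K y -> u y = f y) -> K° x ->
  [/\ {for x, continuous u}, forall l, partial l u x = df l x &
      forall l, {for x, continuous (partial l u)}].
Proof.
move=> [cf cdf Df _] uf Kx.
have near_f y : K° y -> \forall z \near y, f z = u z.
  by move=> Ky; apply: filterS Ky => z /uf.
have du y l : K° y -> partial l u y = df l y.
  move=> Ky; rewrite /partial -(near_eq_derive _ (near_f y Ky)).
  exact: (@derive_val _ _ _ _ _ _ _ (Df y l)).
have nF := nbhs_filter x; split.
- have : u z @[z --> x] --> f x.
    by apply: cvg_trans (cf x); apply: near_eq_cvg; exact: near_f.
  by rewrite -(uf x (interior_subset Kx)).
- by move=> l; exact: du.
- move=> l; have : partial l u z @[z --> x] --> df l x.
    apply: cvg_trans (cdf l x); apply: near_eq_cvg.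
    have : nbhs x K° by apply: open_nbhs_nbhs; split => //; exact: open_interior.
    by apply: filterS => y Ky; rewrite du.
  by rewrite -(du x l Kx).
Qed.

(** On cell interiors the function and its derivatives agree with continuous ones. The derivatives
    are bounded because the cells are compact and finite in number. *)
Lemma piecewise_polynomial_measurable Omega cells E (u : 'rV[R]_n -> R) :
  mesh Omega cells -> piecewise_polynomial cells u -> measurable E ->
  (forall x, E x -> exists2 K, cells K & K° x) ->
  measurable_fun E u /\ forall l, bounded_measurable E (partial l u).
Proof.
move=> [fcells cellP _ _] pu mE EK.
pose G := \bigcup_(K in cells) K°.
have oG : open G by apply: bigcup_open => K _; exact: open_interior.
have mG := open_measurable_rV n G oG.
have EG : E `<=` G by move=> x /EK[K cK Kx]; exists K.
have mE_of (h : 'rV[R]_n -> R) : (forall x, G x -> {for x, continuous h}) -> measurable_fun E h.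
  move=> ch; apply: (measurable_funS mG EG); apply: continuous_measurable_rV => //.
  by move=> x /set_mem /ch.
split=> [|l].
  apply: mE_of => x [K cK Kx]; have [f [df [fP uf]]] := piecewise_poly_fun _ _ _ pu cK.
  by have [] := poly_fun_interior _ _ _ _ _ fP uf Kx.
split.
  apply: mE_of => x [K cK Kx]; have [f [df [fP uf]]] := piecewise_poly_fun _ _ _ pu cK.
  by have [] := poly_fun_interior _ _ _ _ _ fP uf Kx.
have bK K : cells K -> exists C : R, forall x, K° x -> `|partial l u x| <= C.
  move=> cK; have [f [df [fP uf]]] := piecewise_poly_fun _ _ _ pu cK.
  have [_ Kcompact _ _] := (cellP K cK).1; have [_ cdf _ _] := fP.
  have [C _ dfC] := continuous_compact_bounded _ _ Kcompact (cdf l).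
  exists C => x Kx; have [_ -> _] := poly_fun_interior _ _ _ _ _ fP uf Kx.
  exact: dfC (interior_subset Kx).
have /finite_seqP[s sE] := fcells.
have {}bK K : K \in s -> exists C : R, forall x, K° x -> `|partial l u x| <= C.
  by move=> Ks; apply: bK; rewrite sE.
suff [C hC] : exists C : R, forall K, K \in s -> forall x, K° x -> `|partial l u x| <= C.
  by exists C => x /EK[K cK Kx]; apply: (hC K) => //; move: cK; rewrite sE.
elim: s {sE} bK => [_|K s IHs bK]; first by exists 0.
have [|C hC] := IHs; first by move=> K' K's; apply: bK; rewrite inE K's orbT.
have [|D hD] := bK K; first by rewrite inE eqxx.
exists (Num.max C D) => K'; rewrite inE => /orP[/eqP -> x /hD Dx|K's x /(hC _ K's) Cx].
  by rewrite le_max Dx orbT.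
by rewrite le_max Cx.
Qed.

End finite_element_functions.

Lemma coord_le_norm {R : realType} {n : nat} (x : 'rV[R]_n) i : `|x ord0 i| <= `|x|.
Proof.
apply/ler_addgt0Pr => e e0; have xe : 0 < `|x| + e by rewrite ltr_wpDl.
have : ball 0 (`|x| + e) x by rewrite -ball_normE /ball_ /= sub0r normrN ltrDl.
by move/rV_ballP => /(_ xe i); rewrite mxE sub0r normrN => /ltW.
Qed.

(* A combination of basis functions with zero gradient is constant on each
   cell, and then vanishes because it belongs to H^1_0. *)
Lemma stiffness_posdef {R : realType} {n N : nat} (Omega E : set 'rV[R]_n.+1) cells
    (phi : 'I_N -> 'rV[R]_n.+1 -> R) (x : 'rV[R]_N) :
  bounded_domain Omega -> mesh Omega cells -> fe_basis Omega cells phi ->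
  measurable E -> E `<=` Omega -> (lebesgue_rV n.+1).-negligible (Omega `\` E) ->
  (forall t, E t -> exists2 K, cells K & K° t) -> x != 0 ->
  0 < bform R N (stiffness Omega (fun=> 1) phi) x x.
Proof.
move=> [oO _ _ bO] hmesh [ppoly H10phi lin _] mE EO EN EK x0.
have [fcells cellP _ cover] := hmesh.
have mphi j := piecewise_polynomial_measurable _ _ _ _ hmesh (ppoly j) mE EK.
have Ofin : (lebesgue_rV n.+1 Omega < +oo)%E.
  by apply: lebesgue_rV_bounded => //; exact: open_measurable_rV.
have Efin : (lebesgue_rV n.+1 E < +oo)%E.
  by apply: le_lt_trans Ofin; apply: le_measure; rewrite ?inE//; exact: open_measurable_rV.
apply: (bform_stiffness_gt0 _ E) => //; first by move=> j l; have [] := mphi j.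
move=> grad0; move/eqP: x0; apply.
pose u t := \sum_j x ord0 j * phi j t.
have intK_negl K : cells K -> (lebesgue_rV n.+1).-negligible (K° `\` E).
  move=> cK; apply: negligibleS EN => t [Kt Et]; split => //.
  by have [_] := cellP K cK; exact.
have int_neq0 K : cells K -> K° !=set0.
  move=> /cellP[[[t Kt] _ KE _] _]; apply/set0P/eqP => K0.
  by move: Kt; rewrite KE K0 closure0.
have cst K : exists c, cells K -> forall t, K t -> u t = c.
  have [cK|nK] := pselect (cells K); last by exists 0 => /nK.
  have /choice[f /choice[df fP]] j := piecewise_poly_fun _ _ _ (ppoly j) cK.
  pose F t := \sum_j x ord0 j * f j t.
  pose dF l t := \sum_j x ord0 j * df j l t.
  have FP : poly_fun F dF by apply: poly_fun_sum => j; have [] := fP j.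
  have uF t : K t -> u t = F t.
    by move=> Kt; apply: eq_bigr => j _; have [_ ->] := fP j.
  have gradF t l : K° t -> grad phi x l t = dF l t.
    move=> Kt; apply: eq_bigr => j _; have [fPj fE] := fP j.
    by have [_ -> _] := poly_fun_interior _ _ _ _ _ fPj fE Kt.
  (* Almost everywhere becomes everywhere: by continuity, a nonzero value would persist on a
     nonempty open set, which has positive measure. *)
  have dF0 l t : K° t -> dF l t = 0.
    move=> Kt; apply: contrapT => /eqP dFt.
    pose U := K° `&` (dF l @^-1` [set y : R | y != 0]).
    have oU : open U.
      apply: openI; first exact: open_interior.
      apply: open_comp; last exact: open_neq.
      by move=> s _; have [_ cdF _ _] := FP; exact: cdF.
    have U0 : U !=set0 by exists t; split.
    have mU := open_measurable_rV _ _ oU.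
    apply: (measurable_not_negligible _ _ mU (lebesgue_rV_open_gt0 _ _ oU U0)).
    apply: negligibleS (negligibleU grad0 (intK_negl K cK)) => s [Ks dFs].
    have [Es|Es] := pselect (E s); [left|right] => //.
    by split => //; exists l; rewrite gradF.
  have Fcst := poly_fun_constant _ _ _ FP (open_interior K) (int_neq0 K cK) dF0.
  by exists (F 0) => _ t Kt; rewrite uF.
have /choice[c cP] := cst.
have mu : measurable_fun E u.
  apply: measurable_sum => j; apply: measurable_funM; first exact: measurable_cst.
  by have [] := mphi j.
have au : approximable Omega E u.
  apply: approximable_sum => //; first by move=> j; have [] := mphi j.
  by move=> j; exact: H10_approximable.
have [B B0 OB] : exists2 B : R, 0 < B & forall t : 'rV[R]_n.+1, Omega t -> `|t ord0 ord0| < B.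
  have [M [_ MO]] := bO; exists (`|M| + 2); first by rewrite ltr_wpDl.
  move=> t Ot; have tM : `|t| <= `|M| + 1.
    by apply: MO => //; rewrite (le_lt_trans (ler_norm M))// ltrDl.
  by rewrite (le_lt_trans (coord_le_norm _ _))// (le_lt_trans tM)// ltrD2l ltr1n.
have /finite_seqP[s sE] := fcells.
have c0 K : cells K -> c K = 0.
  (* Each cell is treated separately: [K°]&[E] is a set of positive measure on which [u] has the
     single value [c K]. *)
  move=> cK; have mK : measurable (K° `&` E).
    by apply: measurableI => //; apply: open_measurable_rV; exact: open_interior.
  apply: (approximable_finite_range Omega E u B [seq c K | K <- s] (c K) (K° `&` E)) => //.
  - move=> t Et; have [K' cK' K't] := EK t Et.
    rewrite (cP K' cK' t (interior_subset K't)); apply: map_f.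
    by move: cK'; rewrite sE.
  - by move=> t [Kt _]; apply: cP => //; exact: interior_subset.
  - rewrite lt0e measure_ge0 andbT; apply/eqP => K0.
    apply: (measurable_not_negligible (lebesgue_rV n.+1) K°).
    + by apply: open_measurable_rV; exact: open_interior.
    + by apply: lebesgue_rV_open_gt0; [exact: open_interior|exact: int_neq0].
    have nKE : (lebesgue_rV n.+1).-negligible (K° `&` E) by exists (K° `&` E); split.
    apply: negligibleS (negligibleU nKE (intK_negl K cK)) => t Kt.
    by have [Et|Et] := pselect (E t); [left|right].
apply/rowP => j; rewrite mxE; apply: (lin (fun j => x ord0 j)) => t Ot.
have : closure Omega t by exact: subset_closure.
rewrite -cover => -[K cK Kt].
by rewrite -/(u t) (cP K cK t Kt) c0.
Qed.

Theorem theorem3p1 (R : realType) (d : nat) (hd : (1 <= d <= 3)%N)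
  (Omega : set 'rV[R]_d) (hOmega : bounded_domain Omega)
  (cells : set (set 'rV[R]_d)) (hmesh : mesh Omega cells)
  (N : nat) (phi : 'I_N -> 'rV[R]_d -> R) (hphi : fe_basis Omega cells phi)
  (k : 'rV[R]_d -> R)
  (k_meas : Lebesgue_measurable (closure Omega) k)
  (k_bnd : exists M : R, forall x, closure Omega x -> `|k x| <= M)
  (k_pos : exists2 alpha : R, 0 < alpha & forall x, Omega x -> alpha <= k x) :
  let A := stiffness Omega k phi in
  let L := stiffness Omega (fun=> 1) phi in
  (exists lam : 'I_N -> R, ordered_positive_spectrum (invmx L *m A) lam) /\
  forall lam : 'I_N -> R, ordered_positive_spectrum (invmx L *m A) lam ->
    exists pi : 'S_N, forall j : 'I_N,
      lam (pi j) \in range_itv k (supp Omega (phi j)).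
Proof.
case: d hd => [//|n] _ in Omega hOmega cells hmesh phi hphi k k_meas k_bnd k_pos * => A L.
have [oO _ _ bO] := hOmega; have [ppoly _ _ _] := hphi.
have [E [mE EO EN EK mk]] := exists_good_set _ _ _ oO hmesh k_meas.
have mphi j := piecewise_polynomial_measurable _ _ _ _ hmesh (ppoly j) mE EK.
have bphi j l : bounded_measurable E (partial l (phi j)) by have [] := mphi j.
have mO : measurable Omega by exact: open_measurable_rV.
have Efin : (lebesgue_rV n.+1 E < +oo)%E.
  apply: (le_lt_trans _ (lebesgue_rV_bounded _ _ mO bO)).
  by apply: le_measure; rewrite ?inE.
have [M kM] := k_bnd; have [alpha alpha0 ka] := k_pos.
have bk : bounded_measurable E k.
  by split => //; exists M => t Et; apply: kM; apply: subset_closure; exact: EO.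
have Lpos x : x != 0 -> 0 < bform R N L x x by exact: stiffness_posdef hOmega hmesh hphi mE EO EN EK.
have Apos x : x != 0 -> 0 < bform R N A x x.
  move=> x0; apply: lt_le_trans (bform_stiffness_ge _ E _ mE Efin EO EN bphi alpha k x bk _).
    by rewrite mulr_gt0// Lpos.
  by move=> t Et; apply: ka; exact: EO.
have Asym : A^T = A by exact: stiffness_tr.
have Lsym : L^T = L by exact: stiffness_tr.
split; first exact: pencil_ordered_positive_spectrum.
pose T j := k @` supp Omega (phi j).
have T_bnd j y : T j y -> `|y| <= M.
  move=> [t Tt <-]; apply: kM; move: Tt; apply: closure_subset.
  by move=> s [].
have T_ub j : has_ubound (T j).
  by exists M => y /T_bnd; rewrite ler_norml => /andP[].
have T_lb j : has_lbound (T j).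
  by exists (- M) => y /T_bnd; rewrite ler_norml => /andP[].
move=> lam lamP.
have [j|c e w z cw|p pP] := pencil_matching R N A L (fun j => inf (T j)) (fun j => sup (T j))
    Asym Lsym Lpos _ _ lam lamP.
(* On the empty set [inf] and [sup] both take the default value 0. *)
- have [->|/set0P[y Ty]] := eqVneq (T j) set0; first by rewrite inf0 sup0.
  exact: le_trans (ge_inf (T_lb j) Ty) (ub_le_sup (T_ub j) Ty).
- apply: (bform_stiffness_le _ E) => // t Et.
  have [[j wj Tt]|noj] := pselect (exists2 j, w ord0 j != 0 & supp Omega (phi j) t).
    right; have [cj je] := cw j wj; have Tk : T j (k t) by exists t.
    have := ge_inf (T_lb j) Tk; have := ub_le_sup (T_ub j) Tk => h1 h2.
    by rewrite ler_norml; apply/andP; split; lra.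
  left; apply/funext => l; rewrite /grad big1// => j _.
  have [->|wj] := eqVneq (w ord0 j) 0; first by rewrite mul0r.
  (* The support is closed, so [phi j] vanishes in a neighbourhood of [t] and its derivative there
     is zero. *)
  rewrite /partial derive_eq0_near ?mulr0//; apply: (@notin_supp_near0 _ _ Omega).
    by apply: open_nbhs_nbhs; split => //; exact: EO.
  by move=> Tt; apply: noj; exists j.
by exists p => j; rewrite /range_itv in_itv; exact: pP.
Qed.
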